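(* Given a one-dimensional multi-mode system with discrete costs $\mathcal{A}$ and a time horizon $t_{\max}$, a safe schedule with time horizon $t_{\max}$ whose total cost is at most three times the minimum total cost of a safe schedule with time horizon $t_{\max}$ can be computed in time $\mathcal{O}(|\mathcal{A}|^7)$.
   Context: A one-dimensional multi-mode system with discrete costs is a tuple $\mathcal{A}=(M,A,\pi_c,\pi_d,V_{\min},V_{\max},V_0)$ where $M$ is a finite set of modes, $A:M\to\mathbb{Q}$ gives the constant rate of change of a single real variable in each mode, $\pi_c:M\to\mathbb{Q}_{\ge0}$ is the cost per time unit in a mode, $\pi_d:M\to\mathbb{Q}_{\ge0}$ is the cost of switching to a mode, $V_{\min}<V_{\max}$ are rationals and $V_0\in[V_{\min},V_{\max}]$; $|\mathcal{A}|$ denotes the size of its description. A schedule with time horizon $t_{\max}$ is a finite sequence $\sigma=\langle(m_1,t_1),\dots,(m_k,t_k)\rangle$, $m_i\in M$, $t_i>0$, $\sum t_i=t_{\max}$, with run $\langle V_0,\dots,V_k\rangle$, $V_i=V_{i-1}+t_iA(m_i)$; it is safe if $V_i\in[V_{\min},V_{\max}]$ for all $i$; its total cost is $\pi(\sigma)=\sum_i\pi_d(m_i)+\pi_c(m_i)t_i$.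
   Formalization: The time bound is O((|A|+|t_max|)^7), counting the digits of the rational time horizon t_max as input, and the schedule is output run-length encoded, since an explicit schedule or a bound in |A| alone is impossible; if no safe schedule exists, this is reported. *)

(* Defs.v *)
From HB Require Import structures.
From mathcomp Require Import all_boot all_order all_algebra.
From mathcomp Require Import reals.
Set Implicit Arguments.
Unset Strict Implicit.
Unset Printing Implicit Defensive.
Import Order.TTheory GRing.Theory Num.Theory.
Local Open Scope ring_scope.

Record mms := Mms {
  nmodes : nat;
  rate : 'I_nmodes -> rat;
  ccost : 'I_nmodes -> rat;
  dcost : 'I_nmodes -> rat;
  vmin : rat;
  vmax : rat;
  v0 : rat;
  ccost_ge0 : forall m, 0 <= ccost m;
  dcost_ge0 : forall m, 0 <= dcost m;
  vmin_lt_vmax : vmin < vmax;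
  v0_range : vmin <= v0 <= vmax }.

Definition mode (A : mms) : finType := 'I_(nmodes A).

Section Schedules.
Variables (R : realType) (A : mms).

Definition schedule := seq (mode A * R).

Definition has_horizon (tmax : R) (s : schedule) : bool :=
  all (fun x => 0 < x.2) s && (\sum_(x <- s) x.2 == tmax).

Definition run (s : schedule) : seq R :=
  ratr (v0 A) :: scanl (fun v x => v + x.2 * ratr (rate x.1)) (ratr (v0 A)) s.

Definition safe (s : schedule) : bool :=
  all (fun v => ratr (vmin A) <= v <= ratr (vmax A)) (run s).

Definition total_cost (s : schedule) : R :=
  \sum_(x <- s) (ratr (dcost x.1) + ratr (ccost x.1) * x.2).

Definition safe_schedule (tmax : R) (s : schedule) : bool :=
  has_horizon tmax s && safe s.

End Schedules.

(* The number of switches of every safe schedule may be exponential in the    *)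
(* size of the description (e.g. rates 1 and -1, values in [0, 1], horizon    *)
(* 2 ^ n), so schedules are output run-length encoded: an item (r, b) stands  *)
(* for r consecutive copies of the block b, and a step ((m, p), q) of a block *)
(* for mode m during p / q time units (not necessarily in lowest terms).      *)
Definition rle_schedule (A : mms) : Type := seq (nat * seq (mode A * int * int)).

Definition expand (R : realType) (A : mms) (c : rle_schedule A) : schedule R A :=
  flatten [seq flatten (nseq b.1
     [seq (x.1.1, x.1.2%:~R / x.2%:~R) | x <- b.2]) | b <- c].

(* Random access machine with integer cells, under the logarithmic cost       *)
(* criterion; its programs are structured.  Cells are indexed by int, so that *)
(* the nonnegative addresses can hold the input and the output and the        *)
(* negative ones are free work space.                                         *)

(* Number of binary digits of the absolute value, with bits 0 = 1. *)
Definition bits (z : int) : nat := (trunc_log 2 `|z|%N).+1.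

Definition memory := int -> int.

Inductive binop := Add | Sub | Mul | Div.

Inductive expr :=
  | Const of int
  | Read of expr
  | Op of binop & expr & expr.

Inductive cmd :=
  | Skip
  | Store of expr & expr
  | Seq of cmd & cmd
  | If of expr & cmd & cmd
  | While of expr & cmd.

Definition eval_op (o : binop) (x y : int) : int :=
  match o with
  | Add => x + y
  | Sub => x - y
  | Mul => x * y
  | Div => divz x y
  end.

(* Multiplication and division are charged at their schoolbook cost. *)
Definition cost_op (o : binop) (x y : int) : nat :=
  match o with
  | Add | Sub => (bits x + bits y)%N
  | Mul | Div => (bits x * bits y)%N
  end.

Fixpoint eval (mem : memory) (e : expr) : int :=
  match e with
  | Const z => z
  | Read a => mem (eval mem a)
  | Op o e1 e2 => eval_op o (eval mem e1) (eval mem e2)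
  end.

Fixpoint cost_expr (mem : memory) (e : expr) : nat :=
  match e with
  | Const z => bits z
  | Read a => (cost_expr mem a + bits (eval mem a) + bits (mem (eval mem a)))%N
  | Op o e1 e2 =>
      (cost_expr mem e1 + cost_expr mem e2
       + cost_op o (eval mem e1) (eval mem e2))%N
  end.

(* [exec c mem mem' t]: started in mem, c halts in mem' after time t.  A test *)
(* succeeds when the value of its expression is positive.                     *)
Inductive exec : cmd -> memory -> memory -> nat -> Prop :=
  | ExecSkip mem : exec Skip mem mem 1
  | ExecStore mem a e :
      exec (Store a e) mem
        [eta mem with eval mem a |-> eval mem e]
        (cost_expr mem a + cost_expr mem e
         + bits (eval mem a) + bits (eval mem e))%N
  | ExecSeq c1 c2 mem mem1 mem2 t1 t2 :
      exec c1 mem mem1 t1 -> exec c2 mem1 mem2 t2 ->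
      exec (Seq c1 c2) mem mem2 (t1 + t2)%N
  | ExecIfTrue e c1 c2 mem mem' t :
      0 < eval mem e -> exec c1 mem mem' t ->
      exec (If e c1 c2) mem mem' (cost_expr mem e + bits (eval mem e) + t)%N
  | ExecIfFalse e c1 c2 mem mem' t :
      eval mem e <= 0 -> exec c2 mem mem' t ->
      exec (If e c1 c2) mem mem' (cost_expr mem e + bits (eval mem e) + t)%N
  | ExecWhileTrue e c mem mem1 mem2 t1 t2 :
      0 < eval mem e -> exec c mem mem1 t1 -> exec (While e c) mem1 mem2 t2 ->
      exec (While e c) mem mem2
        (cost_expr mem e + bits (eval mem e) + t1 + t2)%N
  | ExecWhileFalse e c mem :
      eval mem e <= 0 ->
      exec (While e c) mem mem (cost_expr mem e + bits (eval mem e))%N.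

Definition encode_rat (q : rat) : seq int := [:: numq q; denq q].

Definition encode_system (A : mms) : seq int :=
  (nmodes A)%:Z :: encode_rat (vmin A) ++ encode_rat (vmax A)
    ++ encode_rat (v0 A)
    ++ flatten [seq encode_rat (rate m) ++ encode_rat (ccost m)
                    ++ encode_rat (dcost m) | m <- enum (mode A)].

Definition encode_input (A : mms) (tmax : rat) : seq int :=
  encode_rat tmax ++ encode_system A.

Definition description_size (s : seq int) : nat := (\sum_(z <- s) bits z)%N.

(* Under the logarithmic cost criterion reading the horizon takes time, and   *)
(* its length is not bounded in terms of the system, so it counts as input.   *)
Definition input_size (A : mms) (tmax : rat) : nat :=
  (description_size (encode_system A) + description_size (encode_rat tmax))%N.

Definition init_memory (s : seq int) : memory :=
  fun a => if a is Posz k then s`_k else 0.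

Definition encode_output (A : mms) (out : option (rle_schedule A)) : seq int :=
  if out is Some c then
    1 :: (size c)%:Z ::
      flatten [seq b.1%:Z :: (size b.2)%:Z ::
        flatten [seq [:: (nat_of_ord x.1.1)%:Z; x.1.2; x.2] | x <- b.2] | b <- c]
  else [:: 0].

Definition holds_output (mem : memory) (s : seq int) : Prop :=
  forall k : nat, (k < size s)%N -> mem k%:Z = s`_k.

(* Main.v *)
Require Import Defs.
From mathcomp Require Import all_boot all_order all_algebra.
From mathcomp Require Import reals.
From mathcomp Require Import zify ring lra.
Import Order.TTheory GRing.Theory Num.Theory.
Local Open Scope ring_scope.

(* Let w be the width of the range.  A visit to mode m of rate a lasts at     *)
(* most w / |a|, so a safe schedule s spending time T m in mode m costs at    *)
(* least the sum of T m (c m + d m |a| / w).  Minimising this linear function *)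
(* under the constraints on the horizon and on the final value leads to a     *)
(* vertex: either a single mode of s used throughout, or two modes of s which *)
(* bring the value exactly to one end of the range.  Such a vertex is         *)
(* realised by alternating the two modes between the two ends of the range,   *)
(* after a short initial phase, and rounding up the numbers of visits costs   *)
(* at most one extra visit to each of the two modes.  As s visits both, this  *)
(* is at most 3 times the cost of s.  The program tries every pair of modes   *)
(* and both ends of the range, on integers of linearly many bits.             *)

(** Charging the switches to a mode in proportion to the time spent there turns the cost into a
    linear function of these times; [total_cost_lb] shows that this function, with rates
    [unit_cost], stays below the true cost. For the times of a safe schedule s, [reduce_support]
    finds one or two modes of s with no larger linear cost: a basic solution of a linear program
    with two constraints, obtained from the exchange argument [exchange_pair]. Only modes visited by
    s occur, so each of their switching costs is at most the cost of s, and [estimate_le] bounds the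
    linear cost plus one extra switch per mode by three times the cost of s.

    Conversely, every admissible choice of modes and target end is realised by an explicit schedule
    costing at most its [estimate]: see [single_candidate], [slow_candidate] and [cycle_candidate].
    The cheapest of these is therefore a 3-approximation, and without an admissible choice there is
    no safe schedule for a positive horizon.

    Let N be the input size. Each candidate takes a loop-free computation on integers of O(N) bits,
    which the static analysis behind [exec_dn] bounds by O(N^2). With k modes there are 2 k^2
    candidates and k is at most N, so the total is O(N^4), within the seventh power. The invariant
    [searched] carries the minimum through the loop. *)

Lemma seq_argmax (F : realFieldType) (I : eqType) (f : I -> F) (s : seq I) (x0 : I) :
  x0 \in s -> exists2 x, x \in s & forall y, y \in s -> f y <= f x.
Proof.
elim: s x0 => // a s IH x0 _.
case: s IH => [|b s] IH.
  by exists a; rewrite ?mem_head // => y; rewrite inE => /eqP ->.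
have [x xs xmax] := IH b (mem_head _ _).
have [le_ax|lt_xa] := lerP (f a) (f x).
  exists x => [|y]; first by rewrite inE xs orbT.
  by rewrite inE => /orP[/eqP -> //|]; apply: xmax.
exists a => [|y]; first exact: mem_head.
by rewrite inE => /orP[/eqP -> //|/xmax /le_trans]; apply; exact: ltW.
Qed.

Lemma sum_gt0_seq (F : realFieldType) (I : eqType) (g : I -> F) (s : seq I) (m : I) :
  m \in s -> 0 < g m -> (forall p, p \in s -> 0 <= g p) -> 0 < \sum_(p <- s) g p.
Proof.
move=> ms gm g0; rewrite (big_rem m) //= ltr_wpDr //.
by rewrite big_seq sumr_ge0 // => p /mem_rem /g0.
Qed.

(* If no such pair existed, the largest ratio l of g to A over the points     *)
(* with A < 0 and g <= 0 would satisfy g >= l A everywhere, strictly where    *)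
(* 0 <= A.                                                                    *)
Lemma exchange_pair (F : realFieldType) (I : eqType) (s : seq I) (tau A g : I -> F) :
  s != [::] -> (forall p, p \in s -> 0 < tau p) ->
  0 <= \sum_(p <- s) tau p * A p -> \sum_(p <- s) tau p * g p <= 0 ->
  (forall p, p \in s -> g p <= 0 -> A p < 0) ->
  exists p q, [/\ p \in s, q \in s, A q < 0, 0 < A p & g p * - A q + g q * A p <= 0].
Proof.
move=> s_neq0 tau_gt0 sumA sumg low.
pose ok p q := [&& A q < 0, 0 < A p & g p * - A q + g q * A p <= 0].
have [/hasP[p ps /hasP[q qs /and3P[]]]|none] := boolP (has (fun p => has (ok p) s) s).
  by exists p, q.
have strict p q : p \in s -> q \in s -> A q < 0 -> 0 < A p -> 0 < g p * - A q + g q * A p.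
  move=> ps qs Aq Ap; move/hasPn: none => /(_ p ps) /hasPn /(_ q qs).
  by rewrite /ok Aq Ap /= -ltNge.
have [m0 m0s] : exists m, m \in s.
  by case: (s) s_neq0 => // m s' _; exists m; exact: mem_head.
have [q0 q0s gq0] : exists2 q, q \in s & g q <= 0.
  apply/hasP; apply: contraLR sumg => /hasPn no.
  rewrite -ltNge; apply: (@sum_gt0_seq _ _ _ _ m0) => // [|p ps].
    by rewrite mulr_gt0 ?tau_gt0 // ltNge no.
  by rewrite mulr_ge0 ?ltW ?tau_gt0 // ltNge no.
pose s' := [seq p <- s | g p <= 0].
have q0s' : q0 \in s' by rewrite mem_filter gq0.
have [q qs' qmax] := @seq_argmax _ _ (fun p => g p / A p) s' q0 q0s'.
move: qs'; rewrite mem_filter => /andP[gq qs].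
have Aq := low q qs gq.
set l := g q / A q in qmax.
have l_ge0 : 0 <= l by rewrite /l mulr_le0 // invr_le0 ltW.
have gq_l : g q = l * A q by rewrite /l divfK // lt_eqF.
have ge_l m : m \in s -> l * A m <= g m.
  move=> ms; have [Am|Am|Am] := ltrgtP (A m) 0; last first.
  - by rewrite Am mulr0 leNgt; apply/negP => /ltW /(low m ms); rewrite Am ltxx.
  - by have := strict m q ms qs Aq Am; rewrite gq_l; nra.
  have [gm|/ltW gm] := lerP (g m) 0; last by apply: le_trans gm; rewrite mulr_ge0_le0 // ltW.
  have /qmax : m \in s' by rewrite mem_filter gm.
  by rewrite ler_ndivrMr.
have gt_l m : m \in s -> 0 <= A m -> l * A m < g m.
  move=> ms; rewrite le_eqVlt => /orP[/eqP Am|Am].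
    by rewrite -Am mulr0 ltNge; apply/negP => /(low m ms); rewrite -Am ltxx.
  by have := strict m q ms qs Aq Am; rewrite gq_l; nra.
have [m ms Am] : exists2 m, m \in s & 0 <= A m.
  apply/hasP; apply: contraLR sumA => /hasPn no; rewrite -ltNge -oppr_gt0 -sumrN.
  apply: (@sum_gt0_seq _ _ _ _ m0) => // [|p ps].
    by rewrite -mulrN mulr_gt0 ?tau_gt0 // oppr_gt0 ltNge no.
  by rewrite -mulrN mulr_ge0 ?ltW ?tau_gt0 // oppr_gt0 ltNge no.
(* As [l] is nonnegative, the signs of the two given sums make this combination nonpositive, a
   contradiction. *)
have : 0 < \sum_(p <- s) tau p * (g p - l * A p).
  apply: (@sum_gt0_seq _ _ _ _ m) => // [|p ps].
    by rewrite mulr_gt0 ?tau_gt0 // subr_gt0 gt_l.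
  by rewrite mulr_ge0 ?subr_ge0 ?ge_l // ltW ?tau_gt0.
under eq_bigr do rewrite mulrBr mulrCA.
rewrite sumrB -mulr_sumr; nra.
Qed.

Section Reduction.
Variables (F : realFieldType) (I : eqType) (s : seq I) (tau : I -> F) (t : F).
Hypotheses (s_neq0 : s != [::]) (tau_gt0 : forall p, p \in s -> 0 < tau p).
Hypothesis sum_tau : \sum_(p <- s) tau p = t.

(** The two times with sum [t] that bring a value starting at [y] exactly to 0 with slopes [a1] and
    [a2], by Cramer's rule. *)
Definition pair_time1 (a1 a2 y : F) := (- a2 * t - y) / (a1 - a2).
Definition pair_time2 (a1 a2 y : F) := (a1 * t + y) / (a1 - a2).

Lemma reduction_t_gt0 : 0 < t.
Proof.
rewrite -sum_tau; case: s s_neq0 tau_gt0 => // m s' _ pos.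
apply: (@sum_gt0_seq _ _ _ _ m); rewrite ?mem_head ?pos ?mem_head //.
by move=> p ps; rewrite ltW ?pos.
Qed.

Lemma pair_le (a1 a2 e1 e2 y K : F) :
  a2 * t + y < 0 -> 0 < a1 * t + y ->
  (e1 * t - K) * - (a2 * t + y) + (e2 * t - K) * (a1 * t + y) <= 0 ->
  e1 * pair_time1 a1 a2 y + e2 * pair_time2 a1 a2 y <= K.
Proof.
have t_gt0 := reduction_t_gt0.
move=> A2 A1 le0; rewrite /pair_time1 /pair_time2.
have D_gt0 : 0 < a1 - a2 by nra.
rewrite !mulrA -mulrDl ler_pdivrMr // -(ler_pM2r t_gt0); nra.
Qed.

(** The exchange argument is applied to the final value [a p * t + y] and the excess cost
    [e p * t - K] that [p] would have if used throughout. Weighted by [tau], the former sums to [t]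
    times the actual final value and the latter to 0. For the pair found, the exchange inequality is
    the cost bound with denominators cleared, which is [pair_le]. *)
Lemma reduce_side (a e : I -> F) (y : F) :
  - y <= \sum_(p <- s) tau p * a p ->
  (forall p, p \in s -> e p * t <= \sum_(p <- s) tau p * e p -> a p * t + y < 0) ->
  exists p q, [/\ p \in s, q \in s, a q * t + y < 0, 0 < a p * t + y &
    e p * pair_time1 (a p) (a q) y + e q * pair_time2 (a p) (a q) y
      <= \sum_(p <- s) tau p * e p].
Proof.
pose K := \sum_(p <- s) tau p * e p; rewrite -/K => ge_y low.
have t_gt0 := reduction_t_gt0.
have [] := @exchange_pair F I s tau (fun p => a p * t + y) (fun p => e p * t - K) => //.
- under eq_bigr do rewrite mulrDr mulrA.
  by rewrite big_split /= -!mulr_suml sum_tau; nra.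
- under eq_bigr do rewrite mulrBr mulrA.
  by rewrite sumrB /= -!mulr_suml sum_tau -/K; nra.
- by move=> p ps gp; apply: low => //; rewrite -subr_le0.
by move=> p [q [ps qs Aq Ap le0]]; exists p, q; split => //; apply: pair_le.
Qed.

(** Call a mode cheap if using it throughout costs at most [K]. If no cheap mode stays in the range,
    each leaves it below or above. When all leave on the same side, [reduce_side] applies at that
    end, after a reflection for the upper one. *)
Lemma reduce_support (a e : I -> F) (y w : F) :
  0 <= y <= w -> 0 <= y + \sum_(p <- s) tau p * a p <= w ->
  let K := \sum_(p <- s) tau p * e p in
  (exists2 p, p \in s & (0 <= y + a p * t <= w) && (e p * t <= K)) \/
  (exists sg p q, let y' := if sg then w - y else y in let b p := (-1) ^+ sg * a p in
     [/\ p \in s, q \in s, b q * t + y' < 0, 0 < b p * t + y' &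
     e p * pair_time1 (b p) (b q) y' + e q * pair_time2 (b p) (b q) y' <= K]).
Proof.
move=> /andP[y_ge0 y_le] /andP[end_ge0 end_le] K.
have t_gt0 := reduction_t_gt0.
have [/hasP[p ps ok]|/hasPn none] :=
    boolP (has (fun p => (0 <= y + a p * t <= w) && (e p * t <= K)) s).
  by left; exists p.
right.
have out p : p \in s -> e p * t <= K -> a p * t + y < 0 \/ w < a p * t + y.
  move=> ps ep; have := none p ps; rewrite ep andbT negb_and -!ltNge addrC => /orP.
  by [].
have [lowP|] := boolP (has (fun p => (e p * t <= K) && (a p * t + y < 0)) s); last first.
  move=> /hasPn nolow; exists true.
  have [||p [q H]] := @reduce_side (fun p => - a p) e (w - y).
  - by under eq_bigr do rewrite mulrN; rewrite sumrN; lra.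
  - move=> p ps ep; have := nolow p ps; rewrite ep /=.
    by case: (out p ps ep) => [->//|]; lra.
  by exists p, q; rewrite /= expr1 !mulN1r.
have [highP|] := boolP (has (fun p => (e p * t <= K) && (w < a p * t + y)) s); last first.
  move=> /hasPn nohigh; exists false.
  have [||p [q H]] := @reduce_side a e y; first lra.
  - move=> p ps ep; have := nohigh p ps; rewrite ep /=.
    by case: (out p ps ep) => [//|->].
  by exists p, q; rewrite /= expr0 !mul1r.
(* With cheap modes leaving on both sides, every mixture of the two costs at most [K]; the lower end
   is chosen as target. *)
have [q qs /andP[eq Aq]] := hasP lowP; have [p ps /andP[ep Ap]] := hasP highP.
exists false, p, q; rewrite /= expr0 !mul1r; split => //; first lra.
apply: pair_le; first by []; first lra.
by nra.
Qed.
End Reduction.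

(** * Schedules and their costs *)

Section Schedules.
Variables (R : realType) (A : mms).
Implicit Types (s : schedule R A) (m i j : mode A) (y t : R) (sg : bool).

Definition width : R := ratr (vmax A) - ratr (vmin A).
Definition elevation : R := ratr (v0 A) - ratr (vmin A).
Definition inside y := 0 <= y <= width.

(* Everything is measured by the distance to a target end of the range, which *)
(* is vmin if sg is false and vmax if sg is true.                             *)
Definition start sg : R := if sg then width - elevation else elevation.
Definition slope sg m : R := (-1) ^+ sg * ratr (rate m).

Fixpoint track sg y s : bool :=
  if s is p :: s' then
    let y' := y + p.2 * slope sg p.1 in inside y' && track sg y' s'
  else true.

Definition endpoint sg y s : R := y + \sum_(p <- s) p.2 * slope sg p.1.

Lemma width_gt0 : 0 < width.
Proof. by rewrite /width subr_gt0 ltr_rat vmin_lt_vmax. Qed.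

Lemma inside_elevation : inside elevation.
Proof.
by have /andP[] := v0_range A; rewrite /inside /elevation /width subr_ge0 lerD2r !ler_rat => -> ->.
Qed.

Lemma inside_start sg : inside (start sg).
Proof.
have := inside_elevation; rewrite /inside /start; case: sg => // /andP[? ?].
by apply/andP; split; lra.
Qed.

Lemma safe_track sg s : safe s = track sg (start sg) s.
Proof.
have gen v y : y = (if sg then ratr (vmax A) - v else v - ratr (vmin A)) ->
   all (fun v => ratr (vmin A) <= v <= ratr (vmax A))
     (scanl (fun v x => v + x.2 * ratr (rate x.1)) v s) = track sg y s.
  elim: s v y => //= p s IH v y yv; set v' := v + _; set y' := y + _.
  have y'v' : y' = if sg then ratr (vmax A) - v' else v' - ratr (vmin A).
    by rewrite /y' yv /v' /slope; case: (sg); rewrite ?expr1 ?expr0; ring.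
  rewrite (IH _ _ y'v'); congr (_ && _); rewrite y'v' /inside /width.
  by case: (sg); rewrite ?subr_ge0 ?lerD2r ?lerD2l ?lerN2 // andbC.
rewrite /safe /run /= !ler_rat v0_range /=; apply: gen.
by rewrite /start /width /elevation; case: sg => //; ring.
Qed.

Lemma track_cat sg y s1 s2 :
  track sg y (s1 ++ s2) = track sg y s1 && track sg (endpoint sg y s1) s2.
Proof.
elim: s1 y => [|p s1 IH] y /=; first by rewrite /endpoint big_nil addr0.
by rewrite IH -andbA /endpoint big_cons addrA.
Qed.

Lemma endpoint_inside sg y s : inside y -> track sg y s -> inside (endpoint sg y s).
Proof.
elim: s y => [|p s IH] y; first by rewrite /endpoint big_nil addr0.
by rewrite /= /endpoint big_cons addrA => _ /andP[/IH].
Qed.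

Lemma track_repeat sg y b n :
  endpoint sg y b = y -> ((0 < n)%N -> track sg y b) ->
  track sg y (flatten (nseq n b)).
Proof.
move=> loop; elim: n => //= n IH ok.
by rewrite track_cat loop ok ?IH // => _; apply: ok.
Qed.

Lemma sum_repeat (T : Type) (f : T -> R) b n :
  \sum_(x <- flatten (nseq n b)) f x = n%:R * \sum_(x <- b) f x.
Proof.
elim: n => [|n IH] /=; first by rewrite big_nil mul0r.
by rewrite big_cat /= IH -natr1 mulrDl mul1r addrC.
Qed.

Lemma all_repeat (T : Type) (P : pred T) b n :
  ((0 < n)%N -> all P b) -> all P (flatten (nseq n b)).
Proof. by elim: n => //= n IH ok; rewrite all_cat ok ?IH // => _; apply: ok. Qed.

(** Common shape of all candidates: optional visits to [j], [i], [j], which reach the target end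
    when two modes are used, then [q] excursions to the opposite end and back. *)
Definition plan i j (e1 e2 e3 q : nat) (x1 x2 x3 z1 z2 : R) : schedule R A :=
  nseq e1 (j, x1) ++ nseq e2 (i, x2) ++ nseq e3 (j, x3)
    ++ flatten (nseq q [:: (i, z1); (j, z2)]).

Definition plan_sum (f : mode A * R -> R) i j (e1 e2 e3 : bool) (q : nat) x1 x2 x3 z1 z2 : R :=
  e1%:R * f (j, x1) + e2%:R * f (i, x2) + e3%:R * f (j, x3)
    + q%:R * (f (i, z1) + f (j, z2)).

Lemma sum_plan f i j (e1 e2 e3 : bool) (q : nat) x1 x2 x3 z1 z2 :
  \sum_(p <- plan i j e1 e2 e3 q x1 x2 x3 z1 z2) f p =
  plan_sum f i j e1 e2 e3 q x1 x2 x3 z1 z2.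
Proof.
rewrite /plan /plan_sum !big_cat /= sum_repeat !big_cons big_nil addr0 !addrA.
have nseqE (e : bool) p : \sum_(x <- nseq e p) f x = e%:R * f p.
  by case: e; rewrite /= ?big_cons big_nil ?addr0 ?mul1r ?mul0r.
by rewrite !nseqE.
Qed.

Lemma plan_safe sg t i j (e1 e2 e3 : bool) (q : nat) x1 x2 x3 z1 z2 :
  let y1 := start sg + e1%:R * (x1 * slope sg j) in
  let y2 := y1 + e2%:R * (x2 * slope sg i) in
  let y3 := y2 + e3%:R * (x3 * slope sg j) in
  [/\ e1 -> 0 < x1, e2 -> 0 < x2, e3 -> 0 < x3
    & ((0 < q)%N -> 0 < z1 /\ 0 < z2)] ->
  plan_sum snd i j e1 e2 e3 q x1 x2 x3 z1 z2 = t ->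
  [/\ inside y1, inside y2, inside y3
    & ((0 < q)%N -> inside (y3 + z1 * slope sg i))] ->
  ((0 < q)%N -> z1 * slope sg i + z2 * slope sg j = 0) ->
  safe_schedule t (plan i j e1 e2 e3 q x1 x2 x3 z1 z2).
Proof.
move=> y1 y2 y3 [x1_gt0 x2_gt0 x3_gt0 z_gt0] sum_t [in1 in2 in3 in4] loop.
have all_nseq_bool (e : bool) (p : mode A * R) (P : pred (mode A * R)) : (e -> P p) -> all P (nseq e p).
  by case: e => //= ->.
apply/andP; split; first apply/andP; first split.
- rewrite !all_cat !all_nseq_bool //= all_repeat // => /z_gt0[/= -> ->].
  by [].
- by rewrite sum_plan sum_t.
have track_nseq (e : bool) y m x : inside (y + e%:R * (x * slope sg m)) -> track sg y (nseq e (m, x)).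
  by case: e => //=; rewrite mul1r => ->.
have end_nseq (e : bool) y m x : endpoint sg y (nseq e (m, x)) = y + e%:R * (x * slope sg m).
  by case: e; rewrite /endpoint /= ?big_cons big_nil ?addr0 ?mul1r // mul0r addr0.
rewrite (safe_track sg) !track_cat !end_nseq -/y1 -/y2 -/y3 !track_nseq //=.
case: (posnP q) => [-> //|q_gt0].
apply: track_repeat => [|_] /=.
  by rewrite /endpoint !big_cons big_nil /= addr0 loop // addr0.
by rewrite in4 //= -addrA loop // addr0 in3.
Qed.
End Schedules.

(** * Lower bound on the cost and explicit candidates *)

Section Bounds.
Variables (R : realType) (A : mms).
Implicit Types (s : schedule R A) (m i j : mode A) (t : R) (sg : bool).

Local Notation cc m := (ratr (ccost m) : R).
Local Notation dc m := (ratr (dcost m) : R).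
Local Notation width := (width R A).
Local Notation elevation := (elevation R A).
Local Notation start := (start R A).
Local Notation slope := (@slope R A).

Lemma cc_ge0 m : 0 <= cc m. Proof. by rewrite ler0q ccost_ge0. Qed.
Lemma dc_ge0 m : 0 <= dc m. Proof. by rewrite ler0q dcost_ge0. Qed.

Lemma norm_slope sg m : `|slope sg m| = `|ratr (rate m)|.
Proof.
by rewrite /slope; case: sg; rewrite ?expr1 ?mulN1r ?normrN ?expr0 ?mul1r.
Qed.

(* One switch to m lasts at most width / |rate m|. *)
Definition unit_cost m : R := cc m + dc m * (`|ratr (rate m)| / width).

Definition rounded_cost m t : R := unit_cost m * t + dc m.

(** These are the two outcomes of [reduce_support]: one mode kept for the whole horizon, or two
    modes whose pair times are positive. *)
Definition fits sg t i j : bool :=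
  if i == j then inside R A (elevation + ratr (rate i) * t)
  else (slope sg j * t + start sg < 0) && (0 < slope sg i * t + start sg).

Definition estimate sg t i j : R :=
  if i == j then rounded_cost i t
  else rounded_cost i (pair_time1 _ t (slope sg i) (slope sg j) (start sg))
     + rounded_cost j (pair_time2 _ t (slope sg i) (slope sg j) (start sg)).

Lemma total_cost_lb s : all (fun p => 0 < p.2) s -> safe s ->
  \sum_(p <- s) p.2 * unit_cost p.1 <= total_cost s.
Proof.
rewrite (safe_track R A false); have := inside_start R A false.
move: (start _) => y; rewrite /total_cost.
elim: s y => [|p s IH] y /=; first by rewrite !big_nil.
move=> y_in /andP[p_gt0 s_gt0] /andP[y'_in /(IH _ y'_in s_gt0) le_s].
rewrite !big_cons lerD // /unit_cost mulrDr addrC lerD ?(mulrC p.2) //.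
rewrite -mulrA ler_piMr ?dc_ge0 // mulrAC ler_pdivrMr ?width_gt0 // mul1r.
rewrite -[X in _ * X <= _](ger0_norm (ltW p_gt0)) -normrM mulrC ler_norml.
move: y_in y'_in; rewrite /inside /slope expr0 mul1r.
by move=> /andP[? ?] /andP[? ?]; apply/andP; split; lra.
Qed.

Lemma switch_cost_le s m : all (fun p => 0 < p.2) s -> m \in map fst s -> dc m <= total_cost s.
Proof.
move=> /allP pos /mapP[p ps ->]; rewrite /total_cost (big_rem p) //=.
have /= p_gt0 := pos p ps.
rewrite -addrA lerDl; apply: addr_ge0; first by rewrite mulr_ge0 ?cc_ge0 // ltW.
rewrite big_seq; apply: sumr_ge0 => r /mem_rem rs.
by apply: addr_ge0; rewrite ?dc_ge0 // mulr_ge0 ?cc_ge0 // ltW //; apply: pos.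
Qed.

Lemma total_cost_ge0 s : all (fun p => 0 < p.2) s -> 0 <= total_cost s.
Proof.
move=> /allP pos; rewrite /total_cost big_seq sumr_ge0 // => r rs.
by apply: addr_ge0; rewrite ?dc_ge0 // mulr_ge0 ?cc_ge0 // ltW //; apply: pos.
Qed.

(** The linear cost of the reduced times is at most the cost of [s], and each of at most two
    roundings adds the switching cost of a mode that [s] visits: 1 + 1 + 1. *)
Lemma estimate_le s t : s != [::] -> safe_schedule t s ->
  exists sg i j, fits sg t i j && (estimate sg t i j <= 3 * total_cost s).
Proof.
move=> s_neq0 /andP[/andP[pos /eqP sum_t] safe_s].
have := total_cost_lb s pos safe_s; have cost_ge0 := total_cost_ge0 s pos.
have in_end : inside R A (elevation + \sum_(p <- s) p.2 * ratr (rate p.1)).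
  have := safe_s; rewrite (safe_track R A false) => /(endpoint_inside _ _ _ _ _ (inside_start R A false)).
  by rewrite /endpoint /slope expr0 /=; under eq_bigr do rewrite mul1r.
have [||[p ps /andP[in_p le_p]]|[sg [p [q]]]] := @reduce_support _ _ s snd t s_neq0 (allP pos) sum_t
  (fun p => ratr (rate p.1)) (fun p => unit_cost p.1) elevation width.
- exact: inside_elevation.
- exact: in_end.
- move=> le_s; exists false, p.1, p.1; rewrite /fits /estimate eqxx /rounded_cost.
  have := switch_cost_le s p.1 pos (map_f _ ps).
  by rewrite [inside _ _ _]in_p /=; lra.
move=> [ps qs neg_q pos_p le_pq le_s]; exists sg, p.1, q.1.
have pq : (p.1 == q.1) = false.
  by apply/eqP => pq; move: neg_q pos_p; rewrite pq; lra.
rewrite /fits /estimate pq neg_q pos_p /= /rounded_cost.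
have := switch_cost_le s p.1 pos (map_f _ ps); have := switch_cost_le s q.1 pos (map_f _ qs).
rewrite /slope /start; lra.
Qed.

(* The data of modes i and j, scaled by Q so as to become integral: times,    *)
(* slopes and running costs are multiplied by Q, positions and switching      *)
(* costs by Q ^ 2.                                                            *)
Section Candidates.
Variables (sg : bool) (t : R) (i j : mode A).
Variables (Q T al be W X Ci Di Cj Dj : R).
Hypotheses (t_gt0 : 0 < t) (Q_gt0 : 0 < Q) (TE : T = t * Q).
Hypotheses (alE : al = slope sg i * Q) (beE : be = - slope sg j * Q).
Hypotheses (WE : W = width * Q ^+ 2) (XE : X = start sg * Q ^+ 2).
Hypotheses (CiE : Ci = cc i * Q) (DiE : Di = dc i * Q ^+ 2).
Hypotheses (CjE : Cj = cc j * Q) (DjE : Dj = dc j * Q ^+ 2).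

(** The pair times of [i] and [j] are [P / (E * Q)] and [S / (E * Q)], and [E] is the scaled
    difference of the slopes. *)
Let P := be * T - X.
Let S := al * T + X.
Let E := al + be.

Let Q_neq0 : Q != 0. Proof. by rewrite gt_eqF. Qed.
Let T_gt0 : 0 < T. Proof. by rewrite TE mulr_gt0. Qed.
Let W_gt0 : 0 < W. Proof. by rewrite WE mulr_gt0 ?exprn_gt0 ?width_gt0. Qed.
Let Q2_gt0 : 0 < Q ^+ 2. Proof. exact: exprn_gt0. Qed.
Let tQ : t = T / Q. Proof. by rewrite TE mulfK. Qed.
Let slope_i : slope sg i = al / Q. Proof. by rewrite alE mulfK. Qed.
Let slope_j : slope sg j = - be / Q. Proof. by rewrite beE; field. Qed.
Let widthQ : width = W / Q ^+ 2. Proof. by rewrite WE mulfK // gt_eqF. Qed.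
Let startQ : start sg = X / Q ^+ 2. Proof. by rewrite XE mulfK // gt_eqF. Qed.
Let cci : cc i = Ci / Q. Proof. by rewrite CiE mulfK. Qed.
Let dci : dc i = Di / Q ^+ 2. Proof. by rewrite DiE mulfK // gt_eqF. Qed.
Let ccj : cc j = Cj / Q. Proof. by rewrite CjE mulfK. Qed.
Let dcj : dc j = Dj / Q ^+ 2. Proof. by rewrite DjE mulfK // gt_eqF. Qed.
Let X_in : 0 <= X <= W.
Proof.
have /andP[? ?] := inside_start R A sg.
by rewrite XE WE ler_pM2r // pmulr_lge0 // ; apply/andP.
Qed.
Let D_ge0 : 0 <= Di /\ 0 <= Dj.
Proof. by rewrite DiE DjE; split; rewrite mulr_ge0 ?dc_ge0 ?sqr_ge0. Qed.

Let insideQ y : inside R A (y / Q ^+ 2) = (0 <= y <= W).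
Proof. by rewrite /inside widthQ ler_pM2r ?invr_gt0 // pmulr_lge0 // invr_gt0. Qed.

Lemma fits_pair : i != j -> fits sg t i j = (0 < P) && (0 < S).
Proof.
move=> /negPf ij; rewrite /fits ij slope_i slope_j startQ tQ.
have -> : - be / Q * (T / Q) + X / Q ^+ 2 = - P / Q ^+ 2 by rewrite /P; field.
have -> : al / Q * (T / Q) + X / Q ^+ 2 = S / Q ^+ 2 by rewrite /S; field.
by rewrite pmulr_llt0 ?invr_gt0 // oppr_lt0 pmulr_lgt0 // invr_gt0.
Qed.

Let be_gt0 : 0 < P -> 0 < be.
Proof. by have /andP[? ?] := X_in; rewrite /P; have := T_gt0; nra. Qed.

Let E_gt0 : 0 < P -> 0 < S -> 0 < E.
Proof. by rewrite /P /S /E; have := T_gt0; nra. Qed.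

Let unit_cost_i : unit_cost i = Ci / Q + Di * `|al| / (W * Q).
Proof.
rewrite /unit_cost; have -> : `|ratr (rate i)| = `|al| / Q.
  by rewrite -(norm_slope sg) alE [in RHS]normrM (gtr0_norm Q_gt0) mulfK.
by rewrite widthQ cci dci; field; rewrite Q_neq0 gt_eqF.
Qed.

Let unit_cost_j : unit_cost j = Cj / Q + Dj * `|be| / (W * Q).
Proof.
rewrite /unit_cost; have -> : `|ratr (rate j)| = `|be| / Q.
  by rewrite -(norm_slope sg) beE [in RHS]mulNr normrN [in RHS]normrM (gtr0_norm Q_gt0) mulfK.
by rewrite widthQ ccj dcj; field; rewrite Q_neq0 gt_eqF.
Qed.

Lemma estimate_pair : i != j -> 0 < P -> 0 < S ->
  estimate sg t i j * (E * Q ^+ 2) =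
  (Ci + Di * `|al| / W) * P + (Cj + Dj * be / W) * S + E * (Di + Dj).
Proof.
move=> /negPf ij P0 S0; rewrite /estimate ij /rounded_cost unit_cost_i unit_cost_j.
rewrite (gtr0_norm (be_gt0 P0)) dci dcj /pair_time1 /pair_time2 slope_i slope_j startQ tQ.
have := gt_eqF (E_gt0 P0 S0); rewrite /P /S /E => E0.
field; rewrite Q_neq0 gt_eqF //=.
by rewrite opprK E0.
Qed.

(** Mode [j] always moves towards the target end, and here [i] does not move away from it. The value
    is thus monotone, and one visit to each mode suffices. *)
Lemma slow_candidate : i != j -> 0 < P -> 0 < S -> al <= 0 ->
  [/\ safe_schedule t (plan R A i j 1 1 0 0 (S / (E * Q)) (P / (E * Q)) 0 0 0),
      total_cost (plan R A i j 1 1 0 0 (S / (E * Q)) (P / (E * Q)) 0 0 0) * (E * Q ^+ 2)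
        = Ci * P + Cj * S + E * (Di + Dj)
    & Ci * P + Cj * S + E * (Di + Dj) <= estimate sg t i j * (E * Q ^+ 2)].
Proof.
move=> ij P0 S0 al0; have E0 := E_gt0 P0 S0; have be0 := be_gt0 P0.
have E_neq0 : al + be != 0 by rewrite gt_eqF.
have /andP[X0 XW] := X_in; have [Di0 Dj0] := D_ge0.
split.
- apply: (@plan_safe R A sg t i j true true false 0) => //.
  + by split=> // _; rewrite divr_gt0 // mulr_gt0.
  + by rewrite /plan_sum /= tQ /P /S /E; field; do ?[by [] | apply/andP; split].
  rewrite /= !mul0r !addr0 !mul1r slope_i slope_j startQ.
  have -> : X / Q ^+ 2 + S / (E * Q) * (- be / Q) = - al * (P / E) / Q ^+ 2.
    by rewrite /P /S /E; field; do ?[by [] | apply/andP; split].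
  have -> : - al * (P / E) / Q ^+ 2 + P / (E * Q) * (al / Q) = 0 / Q ^+ 2.
    by rewrite /P /S /E; field; do ?[by [] | apply/andP; split].
  rewrite !insideQ lexx (ltW W_gt0) mulr_ge0 ?oppr_ge0 ?divr_ge0 ?(ltW P0) ?(ltW E0) //=.
  split=> //; apply: le_trans XW; rewrite mulrA ler_pdivrMr //.
  by move: S0 P0 E0; rewrite /P /S /E; nra.
- rewrite /total_cost (sum_plan R A _ i j true true false 0) /plan_sum /= cci ccj dci dcj.
  by rewrite /P /S /E; field; do ?[by [] | apply/andP; split].
rewrite estimate_pair // lerD2r lerD // ler_pM2r // lerDl divr_ge0 ?mulr_ge0 //; exact: ltW.
Qed.

(** In scaled units, [i] has to climb [al * P / E] in all: [q] full widths and a rest [r / E], which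
    goes into the initial phase. If the start plus this rest exceeds the width ([b]), the value
    first descends to the target end. This takes a second extra visit to [j], but in that case the
    fractional number of descents in the estimate exceeds [q + 1], so its allowance of one more
    still covers it. The flags drop steps of zero duration. *)
Lemma cycle_candidate (q : nat) (r : R) (b : bool) : i != j -> 0 < P -> 0 < S -> 0 < al ->
  r = al * P - q%:R * (E * W) -> 0 <= r < E * W -> b = (W * E < X * E + r) ->
  let e1 := b in let e2 := b || (0 < r) in let e3 := b || (0 < X * E + r) in
  let c := plan R A i j e1 e2 e3 q (X / (be * Q)) (r / (E * al * Q))
    ((if b then r else X * E + r) / (E * be * Q)) (W / (al * Q)) (W / (be * Q)) in
  let num := Ci * P + Cj * S + E * ((e2%:R + q%:R) * Di + (e1%:R + e3%:R + q%:R) * Dj) in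
  [/\ safe_schedule t c, total_cost c * (E * Q ^+ 2) = num
    & num <= estimate sg t i j * (E * Q ^+ 2)].
Proof.
move=> ij P0 S0 al0 rE /andP[r_ge0 r_lt] bE; have E0 := E_gt0 P0 S0; have be0 := be_gt0 P0.
have E_neq0 : al + be != 0 by rewrite gt_eqF.
have al_neq0 : al != 0 by rewrite gt_eqF.
have be_neq0 : be != 0 by rewrite gt_eqF.
have W_neq0 : W != 0 by rewrite gt_eqF.
have /andP[X0 XW] := X_in; have [Di0 Dj0] := D_ge0.
(* Each of [X] and [r / E] alone fits into the width, so an overflow needs both to be positive. *)
have r_b : b -> 0 < r /\ 0 < X.
  rewrite bE => lt_b; have : 0 < r by nra.
  by split=> //; nra.
move=> e1 e2 e3; set x3 := if b then _ else _.
have e2r : e2%:R * r = r.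
  rewrite /e2; have [_|] := boolP (b || (0 < r)); first by rewrite mul1r.
  by rewrite negb_or -leNgt => /andP[_ ?]; have -> : r = 0; [lra | rewrite mulr0].
have e3r : e3%:R * x3 = x3.
  rewrite /e3 /x3; have [_|_] := boolP b; rewrite ?mul1r //=.
  by have [//|?] := ltrP 0 (X * E + r); rewrite ?mul1r //; have -> : X * E + r = 0; [nra | rewrite mulr0].
have e1x : e1%:R * X + x3 / E = X + r / E.
  rewrite /e1 /x3; case: (b); first by rewrite mul1r.
  by rewrite mul0r add0r mulrDl mulfK // gt_eqF.
have x3_le : x3 <= W * E.
  by rewrite /x3; case: (b) bE => bE; [rewrite mulrC ltW | rewrite leNgt -bE].
have x3_ge0 : 0 <= x3 by rewrite /x3; case: (b) => //; nra.
have x3_gt0 : e3 -> 0 < x3.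
  rewrite /e3 /x3; have [/r_b[]|] := boolP b; by [].
move=> c num; split.
- apply: (@plan_safe R A sg t i j) => //.
  + split.
    * by move=> /r_b[_ ?]; rewrite divr_gt0 // mulr_gt0.
    * by case/orP => [/r_b[? _]|?]; rewrite divr_gt0 // !mulr_gt0.
    * by move=> /x3_gt0 ?; rewrite divr_gt0 // !mulr_gt0.
    * by move=> _; rewrite !divr_gt0 // !mulr_gt0.
  + rewrite /plan_sum /=.
    have -> : e1%:R * (X / (be * Q)) = (e1%:R * X) / (be * Q) by rewrite mulrA.
    have -> : e1%:R * X = X + r / E - x3 / E by rewrite -e1x addrK.
    rewrite (mulrA e2%:R) e2r (mulrA e3%:R) e3r tQ rE /P /E.
    field; do ?[by [] | apply/andP; split].
  + rewrite slope_i slope_j startQ.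
    have -> : X / Q ^+ 2 + e1%:R * (X / (be * Q) * (- be / Q)) = (X - e1%:R * X) / Q ^+ 2.
      by field; do ?[by [] | apply/andP; split].
    have -> : X - e1%:R * X = x3 / E - r / E by move: e1x; set u := x3 / E; set v := r / E; set z := _ * X; lra.
    have -> : (x3 / E - r / E) / Q ^+ 2 + e2%:R * (r / (E * al * Q) * (al / Q)) = (x3 / E) / Q ^+ 2.
      rewrite -[r / _ * (al / Q)]mulrA (mulrA e2%:R) e2r /E; field; do ?[by [] | apply/andP; split].
    have -> : x3 / E / Q ^+ 2 + e3%:R * (x3 / (E * be * Q) * (- be / Q)) = 0 / Q ^+ 2.
      rewrite -[x3 / (E * be * Q) * _]mulrA (mulrA e3%:R) e3r /E; field; do ?[by [] | apply/andP; split].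
    have -> : 0 / Q ^+ 2 + W / (al * Q) * (al / Q) = W / Q ^+ 2 by field; do ?[by [] | apply/andP; split].
    have -> : x3 / E - r / E = X - e1%:R * X by move: e1x; set u := x3 / E; set v := r / E; set z := _ * X; lra.
    rewrite !insideQ !lexx (ltW W_gt0) divr_ge0 ?(ltW E0) // ler_pdivrMr // x3_le /e1.
    by split=> //; case: (b); rewrite ?mul1r ?mul0r ?subrr ?subr0 ?lexx ?(ltW W_gt0) ?X0.
  + by move=> _; rewrite slope_i slope_j; field; do ?[by [] | apply/andP; split].
- rewrite /total_cost /c (sum_plan R A) /plan_sum /= cci ccj dci dcj /num.
  have -> : e1%:R * (Dj / Q ^+ 2 + Cj / Q * (X / (be * Q))) =
      e1%:R * (Dj / Q ^+ 2) + (e1%:R * X) * (Cj / Q / (be * Q)) by field; do ?[by [] | apply/andP; split].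
  have -> : e1%:R * X = X + r / E - x3 / E by rewrite -e1x addrK.
  have -> : e2%:R * (Di / Q ^+ 2 + Ci / Q * (r / (E * al * Q))) =
      e2%:R * (Di / Q ^+ 2) + (e2%:R * r) * (Ci / Q / (E * al * Q)).
    by rewrite /E; field; do ?[by [] | apply/andP; split].
  have -> : e3%:R * (Dj / Q ^+ 2 + Cj / Q * (x3 / (E * be * Q))) =
      e3%:R * (Dj / Q ^+ 2) + (e3%:R * x3) * (Cj / Q / (E * be * Q)).
    by rewrite /E; field; do ?[by [] | apply/andP; split].
  rewrite e2r e3r.
  rewrite rE /P /S /E; field; do ?[by [] | apply/andP; split].
rewrite estimate_pair // (gtr0_norm al0) /num.
have rW : al * P = q%:R * (E * W) + r by rewrite rE; ring.
(* By [be * S = al * P + X * E] the estimate becomes a fractional number of visits to each mode, and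
   only the roundings remain to be compared. *)
have -> : (Ci + Di * al / W) * P + (Cj + Dj * be / W) * S + E * (Di + Dj)
   = Ci * P + Cj * S + E * ((1 + (al * P) / (E * W)) * Di + (1 + (al * P + X * E) / (E * W)) * Dj).
  by rewrite /P /S /E; field; do ?[by [] | apply/andP; split].
rewrite lerD2l ler_pM2l // rW.
have EW : E * W != 0 by rewrite gt_eqF // mulr_gt0.
have -> : (q%:R * (E * W) + r) / (E * W) = q%:R + r / (E * W) by rewrite mulrDl mulfK.
have -> : (q%:R * (E * W) + r + X * E) / (E * W) = q%:R + (r + X * E) / (E * W).
  by rewrite -addrA mulrDl mulfK.
have rho_ge0 : 0 <= r / (E * W) by rewrite divr_ge0 // ltW // mulr_gt0.
have xi_ge0 : 0 <= (r + X * E) / (E * W).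
  by rewrite divr_ge0 ?addr_ge0 ?mulr_ge0 // ltW // mulr_gt0.
rewrite lerD // ler_wpM2r //.
  by rewrite /e2; case: (_ || _) => /=; lra.
rewrite /e1 /e3; case: (b) bE => /=.
  move=> bE; have : 1 < (r + X * E) / (E * W).
    by rewrite ltr_pdivlMr ?mulr_gt0 // mul1r; lra.
  lra.
by move=> _; case: (0 < _) => /=; lra.
Qed.
End Candidates.

Lemma single_candidate sg t i j (Q T al W X Ci Di : R) : 0 < t -> 0 < Q -> i = j ->
  T = t * Q -> al = slope sg i * Q -> W = width * Q ^+ 2 -> X = start sg * Q ^+ 2 ->
  Ci = cc i * Q -> Di = dc i * Q ^+ 2 ->
  [/\ fits sg t i j = (0 <= X + al * T <= W),
      0 <= X + al * T <= W -> safe_schedule t (plan R A i j 0 1 0 0 0 (T / Q) 0 0 0),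
      total_cost (plan R A i j 0 1 0 0 0 (T / Q) 0 0 0) * Q ^+ 2 = Ci * T + Di
    & Ci * T + Di <= estimate sg t i j * Q ^+ 2].
Proof.
move=> t_gt0 Q_gt0 <- -> -> -> -> -> ->.
have Q_neq0 : Q != 0 by rewrite gt_eqF.
have Q2_gt0 : 0 < Q ^+ 2 by rewrite exprn_gt0.
have XE : start sg * Q ^+ 2 + slope sg i * Q * (t * Q) = (start sg + slope sg i * t) * Q ^+ 2 by ring.
have inE : (0 <= start sg * Q ^+ 2 + slope sg i * Q * (t * Q) <= width * Q ^+ 2) =
   inside R A (start sg + slope sg i * t).
  by rewrite XE ler_pM2r // pmulr_lge0.
rewrite inE mulfK //; split.
- rewrite /fits eqxx /inside /start /slope; case: (sg); rewrite ?expr0 ?expr1 ?mul1r //.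
  by apply/andP/andP => -[? ?]; split; lra.
- move=> ok; apply: (@plan_safe R A sg t i i false true false 0) => //.
  by rewrite /plan_sum /=; ring.
  by rewrite /= !mul0r !addr0 !mul1r (mulrC t) inside_start ok.
- by rewrite /total_cost (sum_plan R A _ i i false true false 0) /plan_sum /=; ring.
rewrite /estimate eqxx /rounded_cost /unit_cost.
have : 0 <= dc i * (`|ratr (rate i)| / width).
  by rewrite mulr_ge0 ?dc_ge0 // divr_ge0 // ltW // width_gt0.
set u := dc i * _ => u_ge0.
have -> : cc i * Q * (t * Q) + dc i * Q ^+ 2 = (cc i * t + dc i) * Q ^+ 2 by ring.
by rewrite ler_pM2r // lerD2r ler_pM2r // lerDl.
Qed.
End Bounds.

(** * Running time and effect of loop-free programs *)

Section Bits.
Local Open Scope nat_scope.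

Lemma ltn_bits z : `|z| < 2 ^ bits z.
Proof. exact: trunc_log_ltn. Qed.

Lemma bits_leq z b : 0 < b -> `|z| < 2 ^ b -> bits z <= b.
Proof.
move=> b_gt0 zb; rewrite /bits; case: (posnP `|z|) => [->|z_gt0]; first by rewrite trunc_log0.
by rewrite -(@ltn_exp2l 2) //; apply: leq_ltn_trans zb; apply: trunc_logP.
Qed.

Lemma leq_bits x y : `|x| <= `|y| -> bits x <= bits y.
Proof. by move=> xy; apply: bits_leq => //; apply: leq_ltn_trans xy (ltn_bits y). Qed.

Lemma bitsN x : bits (- x)%R = bits x.
Proof. by rewrite /bits abszN. Qed.

Lemma bitsD x y : bits (x + y)%R <= bits x + bits y.
Proof.
apply: bits_leq => //; apply: (@leq_ltn_trans (`|x| + `|y|)); first by lia.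
have := ltn_bits x; have := ltn_bits y; rewrite expnD.
have : 2 <= 2 ^ bits x by rewrite -[X in X <= _]expn1 leq_exp2l.
have : 2 <= 2 ^ bits y by rewrite -[X in X <= _]expn1 leq_exp2l.
move: (2 ^ _) (2 ^ _) => a b; nia.
Qed.

Lemma bitsM x y : bits (x * y)%R <= bits x + bits y.
Proof.
apply: bits_leq => //; rewrite abszM expnD.
exact: ltn_mul (ltn_bits x) (ltn_bits y).
Qed.

Lemma bits_div x y : bits (divz x y) <= bits x.
Proof.
by apply: leq_bits; exact: lez_div.
Qed.

Lemma bits_op o x y : bits (eval_op o x y) <= bits x + bits y.
Proof.
case: o => /=; [exact: bitsD | | exact: bitsM | ].
  by rewrite -(bitsN y); exact: bitsD.
by apply: leq_trans (bits_div x y) _; rewrite leq_addr.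
Qed.

Lemma cost_op_leq o x y : cost_op o x y <= bits x + bits y + bits x * bits y.
Proof. by case: o => /=; rewrite ?leq_addr ?leq_addl. Qed.
End Bits.

(** The same [K] bounds every test and every pass; [n] passes come with [n + 1] tests, hence
    [n.*2.+1]. *)
Lemma exec_while (e : expr) (body : cmd) (I : nat -> memory -> Prop) (K : nat) :
  (forall n mem, I n mem -> (0 < eval mem e) = (0 < n)%N /\
     (cost_expr mem e + bits (eval mem e) <= K)%N) ->
  (forall n mem, I n.+1 mem ->
     exists mem' t, [/\ exec body mem mem' t, (t <= K)%N & I n mem']) ->
  forall n mem, I n mem ->
    exists mem' t, [/\ exec (While e body) mem mem' t, (t <= K * n.*2.+1)%N & I 0%N mem'].
Proof.
move=> test step; elim=> [|n IH] mem In.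
  have [pos le_K] := test _ _ In; exists mem; eexists; split; [|by rewrite muln1; exact: le_K|by []].
  by apply: ExecWhileFalse; rewrite leNgt pos.
have [pos le_K] := test _ _ In; have [mem1 [t1 [ex1 le1 In1]]] := step _ _ In.
have [mem2 [t2 [ex2 le2 I0]]] := IH _ In1.
exists mem2; eexists; split; [by apply: ExecWhileTrue ex1 ex2; rewrite pos| |by []].
move: le_K le1 le2; lia.
Qed.

(* A memory is represented by its nonnegative part and its negative part,     *)
(* both padded with zeros; the cells of the latter are called registers.      *)
Definition state := (seq int * seq int)%type.

Definition rd (st : state) (a : int) : int :=
  match a with Posz k => st.1`_k | Negz r => st.2`_r end.

Definition wr (st : state) (a v : int) : state :=
  match a with
  | Posz k => (set_nth 0 st.1 k v, st.2)
  | Negz r => (st.1, set_nth 0 st.2 r v)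
  end.

Definition sim (mem : memory) (st : state) : Prop := mem =1 rd st.

Fixpoint ev (st : state) (e : expr) : int :=
  match e with
  | Const z => z
  | Read a => rd st (ev st a)
  | Op o e1 e2 => eval_op o (ev st e1) (ev st e2)
  end.

Fixpoint dn (c : cmd) (st : state) : state :=
  match c with
  | Store a e => wr st (ev st a) (ev st e)
  | Seq c1 c2 => dn c2 (dn c1 st)
  | If e c1 c2 => if 0 < ev st e then dn c1 st else dn c2 st
  | _ => st
  end.

Lemma sim_wr mem st a v : sim mem st -> sim [eta mem with a |-> v] (wr st a v).
Proof.
move=> sm b /=; case: eqP => [->|/eqP ba].
  by case: a => k; rewrite /= nth_set_nth /= eqxx.
rewrite sm; case: a b ba => k [l|l] //= kl; rewrite nth_set_nth /=.
  by case: eqP => // lk; case/eqP: kl; rewrite lk.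
by case: eqP => // lk; case/eqP: kl; rewrite lk.
Qed.

Lemma sim_eval mem st e : sim mem st -> eval mem e = ev st e.
Proof. by move=> sm; elim: e => //= [a ->|o e1 -> e2 ->]. Qed.

(* Static analysis of loop-free commands: a coefficient for the nonnegative   *)
(* part and one for each register bound, in units of B, the number of bits of *)
(* the cells.  The only computed addresses are positive offsets of the        *)
(* pointer registers ps.                                                      *)
Definition env := (nat * seq nat)%type.

Definition lk (w : env) (a : int) : nat :=
  match a with Posz _ => w.1 | Negz r => nth 1%N w.2 r end.

Definition up (w : env) (a : int) (k : nat) : env :=
  match a with
  | Posz _ => (maxn w.1 k, w.2)
  | Negz r => (w.1, set_nth 1%N w.2 r k)
  end.

Definition join (w w' : env) : env :=
  (maxn w.1 w'.1, mkseq (fun r => maxn (nth 1%N w.2 r) (nth 1%N w'.2 r))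
                    (maxn (size w.2) (size w'.2))).

Definition bounded (B : nat) (w : env) (st : state) : Prop :=
  (forall k, bits st.1`_k <= w.1 * B)%N /\ (forall r, bits st.2`_r <= nth 1%N w.2 r * B)%N.

(** A computed address is a nonnegative pointer plus an offset, so reading there is bounded by the
    coefficient of the nonnegative part. *)
Fixpoint wt (w : env) (e : expr) : nat :=
  match e with
  | Const z => bits z
  | Read a => if a is Const z then lk w z else w.1
  | Op _ e1 e2 => wt w e1 + wt w e2
  end.

(** Counted in units of [B ^ 2], the schoolbook cost of multiplying two numbers of O(B) bits; linear
    costs are absorbed. *)
Fixpoint wt_time (w : env) (e : expr) : nat :=
  match e with
  | Const z => bits z
  | Read a => wt_time w a + wt w a + wt w (Read a)
  | Op _ e1 e2 => wt_time w e1 + wt_time w e2 + (wt w e1 + wt w e2 + wt w e1 * wt w e2)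
  end.

Fixpoint oke (ps : seq nat) (e : expr) : bool :=
  match e with
  | Const _ => true
  | Read (Const _) => true
  | Read (Op Add (Read (Const (Negz r))) (Const (Posz _))) => r \in ps
  | Read _ => false
  | Op _ e1 e2 => oke ps e1 && oke ps e2
  end.

(** Pointer registers may not be overwritten, so the nonnegativity on which the bounds for reads
    rest survives. *)
Fixpoint okc (ps : seq nat) (c : cmd) : bool :=
  match c with
  | Skip => true
  | Store (Const (Posz _)) e => oke ps e
  | Store (Const (Negz r)) e => (r \notin ps) && oke ps e
  | Store _ _ => false
  | Seq c1 c2 => okc ps c1 && okc ps c2
  | If e c1 c2 => [&& oke ps e, okc ps c1 & okc ps c2]
  | While _ _ => false
  end.

Fixpoint an (c : cmd) (w : env) : env :=
  match c with
  | Store (Const a) e => up w a (wt w e)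
  | Seq c1 c2 => an c2 (an c1 w)
  | If e c1 c2 => join (an c1 w) (an c2 w)
  | _ => w
  end.

Lemma an_seq c1 c2 w : an (Seq c1 c2) w = an c2 (an c1 w).
Proof. by []. Qed.

Fixpoint an_time (c : cmd) (w : env) : nat :=
  match c with
  | Skip => 1
  | Store (Const a) e => bits a + wt_time w e + bits a + wt w e
  | Seq c1 c2 => an_time c1 w + an_time c2 (an c1 w)
  | If e c1 c2 => wt_time w e + wt w e + (an_time c1 w + an_time c2 w)
  | _ => 0
  end.

Definition pointers (ps : seq nat) (st : state) : Prop :=
  forall r, r \in ps -> 0 <= st.2`_r.

Section Analysis.
Variables (ps : seq nat) (B : nat).
Hypothesis B_gt0 : (0 < B)%N.

Lemma wtP w st e : oke ps e -> bounded B w st -> pointers ps st ->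
  (bits (ev st e) <= wt w e * B)%N.
Proof.
move=> ok [b1 b2] ptr; elim: e ok => [z _|a _|o e1 IH1 e2 IH2 /= /andP[ok1 ok2]].
- by rewrite /= leq_pmulr.
- case: a => [[k|r]|//|[] // [//|[[//|r]|//|//]|//] [[k|//]|//|//]] /=.
  + by move=> _; exact: b1.
  + by move=> _; exact: b2.
  + by move=> /ptr; case: (st.2`_r) => //= n _; exact: b1.
apply: leq_trans (bits_op _ _ _) _; rewrite mulnDl.
by rewrite leq_add ?IH1 ?IH2.
Qed.

Lemma wt_timeP w st mem e : oke ps e -> sim mem st -> bounded B w st -> pointers ps st ->
  (cost_expr mem e <= wt_time w e * B ^ 2)%N.
Proof.
move=> ok sm bd ptr.
have B2 : (B <= B ^ 2)%N by rewrite -[X in (X <= _)%N]expn1 leq_pexp2l.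
have B2_gt0 : (0 < B ^ 2)%N by rewrite expn_gt0 B_gt0.
elim: e ok => [z _|a IH ok|o e1 IH1 e2 IH2 /= /andP[ok1 ok2]].
- by rewrite /= leq_pmulr.
- have oka : oke ps a.
    by case: a ok {IH} => [//|//|[] // [//|[[//|r]|//|//]|//] [[k|//]|//|//]].
  have := wtP _ _ _ ok bd ptr; have := wtP _ _ _ oka bd ptr; have := IH oka.
  rewrite -[cost_expr mem (Read a)]/(cost_expr mem a + bits (eval mem a) + bits (mem (eval mem a)))%N.
  rewrite (sim_eval mem st) // sm -[rd st (ev st a)]/(ev st (Read a)).
  rewrite -[wt_time w (Read a)]/(wt_time w a + wt w a + wt w (Read a))%N.
  move: (bits _) (bits _) (cost_expr _ _) (wt w a) (wt_time w a) (wt _ _) => x1 x2 x3 x4 x5 x6; nia.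
have := wtP _ _ _ ok1 bd ptr; have := wtP _ _ _ ok2 bd ptr; have := IH1 ok1; have := IH2 ok2.
rewrite /= !(sim_eval mem st) // => le1 le2 le3 le4.
have := cost_op_leq o (ev st e1) (ev st e2).
move: (cost_op _ _ _) (bits _) (bits _) le1 le2 le3 le4 => x x1 x2.
move: (cost_expr _ _) (cost_expr _ _) (wt _ _) (wt _ _) (wt_time _ _) (wt_time _ _) => y1 y2 w1 w2 v1 v2.
move=> le1 le2 le3 le4 le5; have := leq_mul le4 le3; nia.
Qed.

Lemma bounded_wr w st a v k : bounded B w st -> (bits v <= k * B)%N ->
  bounded B (up w a k) (wr st a v).
Proof.
move=> [b1 b2] vk; case: a => [m|m]; split=> r //=; rewrite nth_set_nth /=.
- case: eqP => _; [apply: leq_trans vk _ | apply: leq_trans (b1 r) _].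
    by rewrite leq_mul2r leq_maxr orbT.
  by rewrite leq_mul2r leq_maxl orbT.
- by rewrite nth_set_nth /=; case: eqP.
Qed.

Lemma bounded_leq w w' st : (w.1 <= w'.1)%N ->
  (forall r, nth 1 w.2 r <= nth 1 w'.2 r)%N -> bounded B w st -> bounded B w' st.
Proof.
move=> le1 le2 [b1 b2]; split=> r; [apply: leq_trans (b1 r) _ | apply: leq_trans (b2 r) _].
  by rewrite leq_mul2r le1 orbT.
by rewrite leq_mul2r le2 orbT.
Qed.

Lemma nth_join w w' r : nth 1%N (join w w').2 r = maxn (nth 1%N w.2 r) (nth 1%N w'.2 r).
Proof.
rewrite /join /=; have [r_lt|] := ltnP r (maxn (size w.2) (size w'.2)).
  by rewrite nth_mkseq.
by move=> r_ge; rewrite !nth_default ?size_mkseq //; lia.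
Qed.

Lemma bounded_joinl w w' st : bounded B w st -> bounded B (join w w') st.
Proof.
by apply: bounded_leq => [|r]; rewrite ?nth_join ?leq_maxl.
Qed.

Lemma bounded_joinr w w' st : bounded B w' st -> bounded B (join w w') st.
Proof.
by apply: bounded_leq => [|r]; rewrite ?nth_join ?leq_maxr.
Qed.

Lemma dn_pointer c st r : okc ps c -> r \in ps -> (dn c st).2`_r = st.2`_r.
Proof.
move=> ok rps; elim: c st ok => //= [[[k|m]|//|//] e st|c1 IH1 c2 IH2 st|e c1 IH1 c2 IH2 st] //=.
- move=> /andP[mps _]; rewrite nth_set_nth /=; case: eqP => // rm.
  by rewrite rm (negPf mps) in rps.
- by move=> /andP[ok1 ok2]; rewrite IH2 ?IH1.
by move=> /and3P[_ ok1 ok2]; case: ifP => _; rewrite ?IH1 ?IH2.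
Qed.

(** The coefficients depend on the command and the initial environment only, not on [B], so for a
    fixed program they are constants. The times of both branches of a test are added up. *)
Lemma exec_dn c w mem st : okc ps c -> sim mem st -> bounded B w st -> pointers ps st ->
  exists mem' t, [/\ exec c mem mem' t, sim mem' (dn c st), bounded B (an c w) (dn c st)
    & (t <= an_time c w * B ^ 2)%N].
Proof.
have B2 : (B <= B ^ 2)%N by rewrite -[X in (X <= _)%N]expn1 leq_pexp2l.
have B2_gt0 : (0 < B ^ 2)%N by rewrite expn_gt0 B_gt0.
elim: c w mem st => [|a e|c1 IH1 c2 IH2|e c1 IH1 c2 IH2|//] w mem st.
- move=> _ sm bd _; exists mem, 1%N; split=> //; first exact: ExecSkip.
  by rewrite mul1n.
- move=> ok sm bd ptr.
  have [z az oke] : exists2 z, a = Const z & oke ps e.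
    by case: a ok => [[k|k]|//|//] /=; [exists k | move=> /andP[_]; exists (Negz k)].
  rewrite {a ok}az; exists [eta mem with z |-> ev st e]; eexists; split.
  + by rewrite -(sim_eval mem) //; exact: ExecStore.
  + exact: sim_wr.
  + by apply: bounded_wr => //; exact: wtP.
  rewrite /= (sim_eval mem st) //; have := wtP _ _ _ oke bd ptr; have := wt_timeP _ _ _ _ oke sm bd ptr.
  move: (bits z) (bits _) (cost_expr _ _) (wt _ _) (wt_time _ _) => x1 x2 x3 x4 x5; nia.
- move=> /= /andP[ok1 ok2] sm bd ptr.
  have [mem1 [t1 [ex1 sm1 bd1 le1]]] := IH1 _ _ _ ok1 sm bd ptr.
  have ptr1 : pointers ps (dn c1 st) by move=> r rps; rewrite dn_pointer // ptr.
  have [mem2 [t2 [ex2 sm2 bd2 le2]]] := IH2 _ _ _ ok2 sm1 bd1 ptr1.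
  exists mem2, (t1 + t2)%N; split=> //; first exact: ExecSeq ex1 ex2.
  by rewrite mulnDl leq_add.
move=> /= /and3P[oke ok1 ok2] sm bd ptr.
have := wtP _ _ _ oke bd ptr; have := wt_timeP _ _ _ _ oke sm bd ptr; rewrite -(sim_eval mem) // => le_t le_b.
case: ifP => [pos|/negbT]; last rewrite -leNgt => neg.
  have [mem1 [t1 [ex1 sm1 bd1 le1]]] := IH1 _ _ _ ok1 sm bd ptr.
  exists mem1; eexists; split; [exact: (ExecIfTrue _ pos ex1) | by [] | exact: bounded_joinl|].
  move: le_t le_b le1; move: (bits _) (cost_expr _ _) (wt _ _) (wt_time _ _) => x1 x2 x3 x4.
  move: (an_time _ _) (an_time _ _) => y1 y2; nia.
have [mem1 [t1 [ex1 sm1 bd1 le1]]] := IH2 _ _ _ ok2 sm bd ptr.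
exists mem1; eexists; split; [exact: (ExecIfFalse _ neg ex1) | by [] | exact: bounded_joinr|].
move: le_t le_b le1; move: (bits _) (cost_expr _ _) (wt _ _) (wt_time _ _) => x1 x2 x3 x4.
move: (an_time _ _) (an_time _ _) => y1 y2; nia.
Qed.
End Analysis.

(** * The program *)

Section Programs.
Declare Scope prog_scope.
Delimit Scope prog_scope with P.
Local Notation "a + b" := (Op Defs.Add a b) : prog_scope.
Local Notation "a - b" := (Op Defs.Sub a b) : prog_scope.
Local Notation "a * b" := (Op Defs.Mul a b) : prog_scope.
Local Notation "a %/ b" := (Op Defs.Div a b) : prog_scope.
Local Notation "# n" := (Const (Posz n%N)) (at level 1, format "# n") : prog_scope.
Local Notation reg r := (Read (Const (Negz r%N))).
Local Notation cell k := (Read (Const (Posz k%N))).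
Local Notation field p k := (Read (Op Defs.Add (Read (Const (Negz p%N))) (Const (Posz k%N)))).
Local Notation "r <~ e" := (Store (Const (Negz r%N)) e%P) (at level 85, no associativity) : prog_scope.
Local Notation "c1 ;; c2" := (Seq c1 c2) (at level 90, right associativity) : prog_scope.

Local Notation rC := 0%N. Local Notation rI := 1%N. Local Notation rJ := 2%N. Local Notation rS := 3%N.
Local Notation rQ := 4%N. Local Notation rT := 5%N. Local Notation rA := 6%N. Local Notation rB := 7%N.
Local Notation rW := 8%N. Local Notation rX := 9%N. Local Notation rCi := 10%N. Local Notation rDi := 11%N.
Local Notation rCj := 12%N. Local Notation rDj := 13%N.
Local Notation rV := 14%N. Local Notation rP := 15%N. Local Notation rZ := 16%N. Local Notation rE := 17%N.
Local Notation rR := 18%N.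
Local Notation rE1 := 19%N. Local Notation rP1 := 20%N. Local Notation rQ1 := 21%N.
Local Notation rE2 := 22%N. Local Notation rP2 := 23%N. Local Notation rQ2 := 24%N.
Local Notation rE3 := 25%N. Local Notation rP3 := 26%N. Local Notation rQ3 := 27%N.
Local Notation rE4 := 28%N. Local Notation rN := 29%N. Local Notation rD := 30%N.

Definition init_prog : cmd := (
  rC <~ #2 * cell 2 * cell 2;;
  31 <~ #1;; 32 <~ #0)%P.

(* The counter n stands for the candidate (n odd, n/2 div k, n/2 mod k) where  *)
(* k is the number of modes; registers 1 and 2 point to the two modes.        *)
Definition decode_prog : cmd := (
  rC <~ reg rC - #1;;
  rI <~ #9 + #6 * (reg rC %/ (#2 * cell 2));;
  rJ <~ #9 + #6 * (reg rC %/ #2 - (reg rC %/ (#2 * cell 2)) * cell 2);;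
  rS <~ #1 - #2 * (reg rC - #2 * (reg rC %/ #2)))%P.

Local Notation scaled n d := (n * (reg rQ %/ d))%P.

(** Cells 0 and 1 hold the horizon, 2 the number of modes, 3 to 8 the range and the initial value;
    each mode takes six cells from 9 on. The scale [Q] is the product of the ten denominators
    involved: the divisions are exact and [Q] has O(N) bits. *)
Definition load_prog : cmd := (
  rQ <~ cell 1 * cell 4 * cell 6 * cell 8 * field rI 1 * field rI 3 * field rI 5
          * field rJ 1 * field rJ 3 * field rJ 5;;
  rT <~ scaled (cell 0) (cell 1);;
  rA <~ reg rS * scaled (field rI 0) (field rI 1);;
  rB <~ #0 - reg rS * scaled (field rJ 0) (field rJ 1);;
  rW <~ reg rQ * (scaled (cell 5) (cell 6) - scaled (cell 3) (cell 4));;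
  If (reg rS)
    (rX <~ reg rQ * (scaled (cell 7) (cell 8) - scaled (cell 3) (cell 4)))
    (rX <~ reg rQ * (scaled (cell 5) (cell 6) - scaled (cell 7) (cell 8)));;
  rCi <~ scaled (field rI 2) (field rI 3);;
  rDi <~ reg rQ * scaled (field rI 4) (field rI 5);;
  rCj <~ scaled (field rJ 2) (field rJ 3);;
  rDj <~ reg rQ * scaled (field rJ 4) (field rJ 5))%P.

Definition single_prog : cmd := (
  rP <~ reg rX + reg rA * reg rT;;
  If (reg rP + #1)
    (If (reg rW - reg rP + #1)
      (rV <~ #1;;
       rE1 <~ #0;; rP1 <~ #0;; rQ1 <~ #1;;
       rE2 <~ #1;; rP2 <~ reg rT;; rQ2 <~ reg rQ;;
       rE3 <~ #0;; rP3 <~ #0;; rQ3 <~ #1;; rE4 <~ #0;;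
       rN <~ reg rCi * reg rT + reg rDi;; rD <~ reg rQ * reg rQ)
      Skip)
    Skip)%P.

Definition cycle_prog : cmd := (
  rE4 <~ (reg rA * reg rP) %/ (reg rE * reg rW);;
  rR <~ reg rA * reg rP - reg rE4 * (reg rE * reg rW);;
  rP1 <~ reg rX;; rQ1 <~ reg rB * reg rQ;;
  rP2 <~ reg rR;; rQ2 <~ reg rE * reg rA * reg rQ;;
  rQ3 <~ reg rE * reg rB * reg rQ;;
  If (reg rX * reg rE + reg rR - reg rW * reg rE)
    (rE1 <~ #1;; rE2 <~ #1;; rE3 <~ #1;; rP3 <~ reg rR)
    (rE1 <~ #0;; rP3 <~ reg rX * reg rE + reg rR;;
     If (reg rR) (rE2 <~ #1) (rE2 <~ #0);;
     If (reg rP3) (rE3 <~ #1) (rE3 <~ #0)))%P.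

Definition slow_prog : cmd := (
  rE4 <~ #0;;
  rE1 <~ #1;; rP1 <~ reg rZ;; rQ1 <~ reg rE * reg rQ;;
  rE2 <~ #1;; rP2 <~ reg rP;; rQ2 <~ reg rE * reg rQ;;
  rE3 <~ #0;; rP3 <~ #0;; rQ3 <~ #1)%P.

Definition pair_prog : cmd := (
  rP <~ reg rB * reg rT - reg rX;;
  rZ <~ reg rA * reg rT + reg rX;;
  rE <~ reg rA + reg rB;;
  If (reg rP)
    (If (reg rZ)
      (rV <~ #1;; rD <~ reg rE * (reg rQ * reg rQ);;
       If (reg rA) cycle_prog slow_prog;;
       rN <~ reg rCi * reg rP + reg rCj * reg rZ
               + reg rE * ((reg rE2 + reg rE4) * reg rDi
                           + (reg rE1 + reg rE3 + reg rE4) * reg rDj))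
      Skip)
    Skip)%P.

(** Tests succeed on positive values only, and [1 - d * d] is positive for an integer d exactly when
    d is 0. *)
Definition plan_prog : cmd := (
  rV <~ #0;;
  If (#1 - (reg rI - reg rJ) * (reg rI - reg rJ)) single_prog pair_prog)%P.

(* Registers 31 and 32 hold the numerator and the denominator of the least    *)
(* cost found so far, initially 1 / 0, and registers 33 to 47 its schedule.   *)
Definition update_prog : cmd := (
  If (reg rV)
    (If (reg 31 * reg rD - reg rN * reg 32)
       (31 <~ reg rN;; 32 <~ reg rD;;
        33 <~ (reg rI - #9) %/ #6;; 34 <~ (reg rJ - #9) %/ #6;;
        35 <~ reg rE1;; 36 <~ reg rP1;; 37 <~ reg rQ1;;
        38 <~ reg rE2;; 39 <~ reg rP2;; 40 <~ reg rQ2;;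
        41 <~ reg rE3;; 42 <~ reg rP3;; 43 <~ reg rQ3;;
        44 <~ reg rE4;; 45 <~ reg rW;;
        46 <~ reg rA * reg rQ;; 47 <~ reg rB * reg rQ)
       Skip)
    Skip)%P.

Definition main_prog : cmd := (load_prog;; plan_prog;; update_prog)%P.

Local Notation "k <= e" := (Store (Const (Posz k%N)) e%P) : prog_scope.

Definition output_prog : cmd := (
  If (reg 32)
    (0 <= #1;; 1 <= #4;;
     2 <= reg 35;; 3 <= #1;; 4 <= reg 34;; 5 <= reg 36;; 6 <= reg 37;;
     7 <= reg 38;; 8 <= #1;; 9 <= reg 33;; 10 <= reg 39;; 11 <= reg 40;;
     12 <= reg 41;; 13 <= #1;; 14 <= reg 34;; 15 <= reg 42;; 16 <= reg 43;;
     17 <= reg 44;; 18 <= #2;; 19 <= reg 33;; 20 <= reg 45;; 21 <= reg 46;;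
     22 <= reg 34;; 23 <= reg 45;; 24 <= reg 47)
    (0 <= #0))%P.

Definition empty_prog : cmd := (0 <= #1;; 1 <= #0)%P.

Definition loop_body : cmd := Seq decode_prog main_prog.

Definition search_prog : cmd :=
  Seq init_prog (Seq (While (reg rC) loop_body) output_prog).

Definition solver : cmd := If (cell 0) search_prog empty_prog.
End Programs.

(* A fixed point of the analysis of the loop body, except for the counter,    *)
(* whose bound 4 comes from its being at most 2 k ^ 2.                        *)
Definition loop_env : env :=
  (1%N, set_nth 1%N (an loop_body (1%N, 4%N :: nseq 47 1%N)).2 0 4%N).

Definition renews (w v : env) : bool :=
  [&& (w.1 <= v.1)%N, size w.2 == 48%N, size v.2 == 48%N, nth 1%N v.2 0 == 4%N
    & all (fun r => nth 1 w.2 r <= nth 1 v.2 r)%N (iota 1 47)].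

Lemma bounded_renews w v B st : renews w v -> bounded B w st ->
  (bits st.2`_0 <= 4 * B)%N -> bounded B v st.
Proof.
case/and5P=> le1 /eqP sz_w /eqP sz_v /eqP v0 /allP le2 [bd1 bd2] le0.
split=> [k|[|r]]; first by apply: leq_trans (bd1 k) _; rewrite leq_mul2r le1 orbT.
  by rewrite v0.
apply: leq_trans (bd2 r.+1) _; rewrite leq_mul2r.
have [r_lt|r_ge] := ltnP r.+1 48; first by rewrite le2 ?orbT // mem_iota.
by rewrite !nth_default ?sz_w ?sz_v ?leqnn ?orbT.
Qed.

(** Bounds do not accumulate: an iteration keeps a register or recomputes it from the input and the
    counter. Only the counter is exempt, as its static bound grows with each decrement. *)
Lemma loop_env_renews : renews (an loop_body loop_env) loop_env.
Proof. by vm_compute. Qed.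

Lemma okc_decode : okc [::] decode_prog. Proof. by []. Qed.
Lemma okc_main : okc [:: 1%N; 2%N] main_prog. Proof. by []. Qed.
Lemma okc_output : okc [::] output_prog. Proof. by []. Qed.
Lemma okc_init : okc [::] init_prog. Proof. by []. Qed.
Lemma okc_empty : okc [::] empty_prog. Proof. by []. Qed.

(** * Symbolic execution of the program *)

Lemma dn_reg r e c inp regs :
  dn (Seq (Store (Const (Negz r)) e) c) (inp, regs) =
  dn c (inp, set_nth 0 regs r (ev (inp, regs) e)).
Proof. by []. Qed.

Lemma dn_reg1 r e inp regs :
  dn (Store (Const (Negz r)) e) (inp, regs) = (inp, set_nth 0 regs r (ev (inp, regs) e)).
Proof. by []. Qed.

Lemma dn_if e c1 c2 c st :
  dn (Seq (If e c1 c2) c) st =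
  if 0 < ev st e then dn (Seq c1 c) st else dn (Seq c2 c) st.
Proof. by rewrite /=; case: ifP. Qed.

Lemma dn_if1 e c1 c2 st :
  dn (If e c1 c2) st = if 0 < ev st e then dn c1 st else dn c2 st.
Proof. by []. Qed.

Lemma dn_seq c1 c2 st : dn (Seq c1 c2) st = dn c2 (dn c1 st).
Proof. by []. Qed.

Lemma dn_seqA c1 c2 c3 st : dn (Seq (Seq c1 c2) c3) st = dn (Seq c1 (Seq c2 c3)) st.
Proof. by []. Qed.

(** Each assigned value becomes a variable with a defining equation, which keeps the symbolic
    register list small. *)
Ltac run v H :=
  first [rewrite dn_reg | rewrite dn_reg1];
  match goal with |- context [set_nth _ _ _ (ev ?st ?e)] =>
    remember (ev st e) as v eqn:H; simpl in H; cbn [set_nth]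
  end.

Ltac step v H := rewrite ?dn_seqA; run v H.

Ltac branch H :=
  first [rewrite dn_if | rewrite dn_if1];
  match goal with |- context [if 0 < ev ?st ?e then _ else _] =>
    let x := fresh "x" in let xE := fresh "xE" in
    remember (ev st e) as x eqn:xE; simpl in xE; rewrite xE {x xE}; case: ifP => H
  end.

Lemma dn_load (inp : seq int) x0 (a b : nat) s x4 x5 x6 x7 x8 x9 x10 x11 x12 x13 rest :
  exists Q T al be W X Ci Di Cj Dj : int,
    let scaled n d := inp`_n * divz Q inp`_d in
    dn load_prog (inp, [:: x0, Posz a, Posz b, s, x4, x5, x6, x7, x8, x9, x10, x11, x12, x13 & rest])
      = (inp, [:: x0, Posz a, Posz b, s, Q, T, al, be, W, X, Ci, Di, Cj, Dj & rest]) /\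
    [/\ Q = inp`_1 * inp`_4 * inp`_6 * inp`_8 * inp`_(a + 1)%N * inp`_(a + 3)%N * inp`_(a + 5)%N
              * inp`_(b + 1)%N * inp`_(b + 3)%N * inp`_(b + 5)%N,
        T = scaled 0 1 /\ W = Q * (scaled 5 6 - scaled 3 4),
        al = s * scaled (a + 0)%N (a + 1)%N /\ be = - (s * scaled (b + 0)%N (b + 1)%N),
        X = Q * (if 0 < s then scaled 7 8 - scaled 3 4 else scaled 5 6 - scaled 7 8)
      & [/\ Ci = scaled (a + 2)%N (a + 3)%N, Di = Q * scaled (a + 4)%N (a + 5)%N,
            Cj = scaled (b + 2)%N (b + 3)%N & Dj = Q * scaled (b + 4)%N (b + 5)%N]].
Proof.
rewrite /load_prog.
run Q QE; run T TE; run al alE; run be beE; run W WE.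
branch sE; run X XE; run Ci CiE; run Di DiE; run Cj CjE; run Dj DjE;
  exists Q, T, al, be, W, X, Ci, Di, Cj, Dj; split=> //; split=> //;
  by split=> //; rewrite beE sub0r.
Qed.

Definition rle (A : mms) (i j : mode A) (e1 p1 q1 e2 p2 q2 e3 p3 q3 e4 w q4 q5 : int) :
    rle_schedule A :=
  [:: (`|e1|%N, [:: (j, p1, q1)]); (`|e2|%N, [:: (i, p2, q2)]); (`|e3|%N, [:: (j, p3, q3)]);
      (`|e4|%N, [:: (i, w, q4); (j, w, q5)])].

Section Semantics.
Variables (R : realType) (A : mms).
Implicit Types (i j : mode A).

Lemma expand_rle i j e1 p1 q1 e2 p2 q2 e3 p3 q3 e4 w q4 q5 :
  expand R (rle A i j e1 p1 q1 e2 p2 q2 e3 p3 q3 e4 w q4 q5) =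
  plan R A i j `|e1| `|e2| `|e3| `|e4| (p1%:~R / q1%:~R) (p2%:~R / q2%:~R) (p3%:~R / q3%:~R)
    (w%:~R / q4%:~R) (w%:~R / q5%:~R).
Proof.
have flat1 (T : Type) n (x : T) : flatten (nseq n [:: x]) = nseq n x by elim: n => //= n ->.
by rewrite /expand /rle /= !flat1 cats0.
Qed.

(** The contract on which the search relies: [V] tells whether a candidate was built, and
    [num / den] is its exact cost. *)
Definition planned (sg : bool) (t : R) i j
    (V e1 p1 q1 e2 p2 q2 e3 p3 q3 e4 w q4 q5 num den : int) : Prop :=
  let c := expand R (rle A i j e1 p1 q1 e2 p2 q2 e3 p3 q3 e4 w q4 q5) in
  (0 < V ->
   [/\ 0 < den, [/\ 0 <= e1, 0 <= e2, 0 <= e3 & 0 <= e4], safe_schedule t c,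
       total_cost c * den%:~R = num%:~R & num%:~R <= estimate R A sg t i j * den%:~R]) /\
  (fits R A sg t i j -> 0 < V).

Lemma dn_plan (inp : seq int) (sg : bool) (t : R) i j
    x0 s (Q T al be W X Ci Di Cj Dj : int)
    x14 x15 x16 x17 x18 x19 x20 x21 x22 x23 x24 x25 x26 x27 x28 x29 x30 rest :
  let a := Posz (9 + 6 * i)%N in let b := Posz (9 + 6 * j)%N in
  0 < t -> 0 < Q -> T%:~R = t * Q%:~R ->
  al%:~R = slope R A sg i * Q%:~R -> be%:~R = - slope R A sg j * Q%:~R ->
  W%:~R = width R A * Q%:~R ^+ 2 -> X%:~R = start R A sg * Q%:~R ^+ 2 ->
  Ci%:~R = (ratr (ccost i) : R) * Q%:~R -> Di%:~R = (ratr (dcost i) : R) * Q%:~R ^+ 2 ->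
  Cj%:~R = (ratr (ccost j) : R) * Q%:~R -> Dj%:~R = (ratr (dcost j) : R) * Q%:~R ^+ 2 ->
  exists V y15 y16 y17 y18 e1 p1 q1 e2 p2 q2 e3 p3 q3 e4 num den : int,
    dn plan_prog (inp, [:: x0, a, b, s, Q, T, al, be, W, X, Ci, Di, Cj, Dj,
      x14, x15, x16, x17, x18, x19, x20, x21, x22, x23, x24, x25, x26, x27, x28, x29, x30 & rest])
    = (inp, [:: x0, a, b, s, Q, T, al, be, W, X, Ci, Di, Cj, Dj,
      V, y15, y16, y17, y18, e1, p1, q1, e2, p2, q2, e3, p3, q3, e4, num, den & rest]) /\
    planned sg t i j V e1 p1 q1 e2 p2 q2 e3 p3 q3 e4 W (al * Q) (be * Q) num den.
Proof.
move=> a b t_gt0 Q_gt0 TE alE beE WE XE CiE DiE CjE DjE.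
have Q_gt0' : 0 < Q%:~R :> R by rewrite ltr0z.
rewrite /plan_prog; run V VE.
branch ijE; last first.
  have ij : i != j.
    by apply/eqP => ij; move: ijE; rewrite /a /b ij subrr mulr0 subr0.
  have PR Pe : Pe = be * T - X -> Pe%:~R = be%:~R * T%:~R - X%:~R :> R.
    by move=> ->; rewrite rmorphB rmorphM.
  have ZR Ze : Ze = al * T + X -> Ze%:~R = al%:~R * T%:~R + X%:~R :> R.
    by move=> ->; rewrite rmorphD rmorphM.
  rewrite /pair_prog; run P PE; run Z ZE; run E EE.
  have {}PR := PR _ PE; have {}ZR := ZR _ ZE.
  have ER : E%:~R = al%:~R + be%:~R :> R by rewrite EE rmorphD.
  have := fits_pair R A sg t i j _ _ _ _ _ Q_gt0' TE alE beE XE ij; rewrite -PR -ZR !ltr0z => fitsE.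
  branch P0; last first.
    do 17 eexists; split; [reflexivity | split; rewrite VE ?ltxx //].
    by rewrite fitsE P0.
  branch Z0; last first.
    do 17 eexists; split; [reflexivity | split; rewrite VE ?ltxx //].
    by rewrite fitsE P0 Z0.
  run V' V'E; run den denE.
  have P0R : 0 < P%:~R :> R by rewrite ltr0z.
  have Z0R : 0 < Z%:~R :> R by rewrite ltr0z.
  have W0 : 0 < W.
    by rewrite -(ltr0z R) WE mulr_gt0 ?exprn_gt0 ?width_gt0.
  have X0 : 0 <= X <= W.
    by rewrite -(ler0z R) -(ler_int R) WE XE ler_pM2r ?exprn_gt0 // pmulr_lge0 ?exprn_gt0 //; exact: inside_start.
  have T0 : 0 < T by rewrite -(ltr0z R) TE mulr_gt0.
  have be0 : 0 < be by move: P0 X0 => + /andP[? ?]; rewrite PE; nia.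
  have E0 : 0 < E by rewrite EE; move: P0 Z0; rewrite PE ZE; nia.
  have denR : den%:~R = E%:~R * Q%:~R ^+ 2 :> R by rewrite denE !rmorphM expr2.
  have den0 : 0 < den by rewrite denE !mulr_gt0.
  branch al0; last first.
    rewrite /slow_prog; step e4 e4E; step e1 e1E; step p1 p1E; step q1 q1E.
    step e2 e2E; step p2 p2E; step q2 q2E; step e3 e3E; step p3 p3E; step q3 q3E; step num numE.
    have al_le0 : al%:~R <= 0 :> R by rewrite lerz0 leNgt al0.
    have := slow_candidate R A sg t i j _ _ _ _ _ _ _ _ _ _ t_gt0 Q_gt0' TE alE beE WE XE CiE DiE CjE DjE ij.
    rewrite -PR -ZR -ER => /(_ P0R Z0R al_le0).
    have numR : num%:~R = Ci%:~R * P%:~R + Cj%:~R * Z%:~R + E%:~R * (Di%:~R + Dj%:~R) :> R.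
      by rewrite numE e1E e2E e3E e4E !(rmorphD, rmorphM) /=; ring.
    rewrite -numR -denR => H.
    do 17 eexists; split; [reflexivity | split; last by rewrite V'E].
    move=> _; rewrite expand_rle p1E q1E p2E q2E e1E e2E e3E e4E !rmorphM.
    by case: H.
  rewrite /cycle_prog; step q qE; step r rE; step p1 p1E; step q1 q1E.
  step p2 p2E; step q2 q2E; step q3 q3E; rewrite ?dn_seqA.
  have EW0 : 0 < E * W by rewrite mulr_gt0.
  have rmod : r = modz (al * P) (E * W) by rewrite rE qE.
  have r_ge0 : 0 <= r by rewrite rmod modz_ge0 // gt_eqF.
  have r_lt : r < E * W by rewrite rmod ltz_pmod.
  have q_ge0 : 0 <= q by rewrite qE divz_ge0 // mulr_ge0 // ltW.
  have qR : `|q|%:R = q%:~R :> R by rewrite natr_absz ger0_norm.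
  have rR : r%:~R = al%:~R * P%:~R - `|q|%:R * (E%:~R * W%:~R) :> R.
    by rewrite qR rE rmorphB !rmorphM.
  have r_in : 0 <= (r%:~R : R) < E%:~R * W%:~R by rewrite -rmorphM ler0z ltr_int r_ge0.
  have longE : (0 < X * E + r - W * E) = (W%:~R * E%:~R < X%:~R * E%:~R + r%:~R :> R).
    by rewrite -!rmorphM -rmorphD ltr_int subr_gt0.
  have al0R : 0 < al%:~R :> R by rewrite ltr0z.
  have := cycle_candidate R A sg t i j _ _ _ _ _ _ _ _ _ _ t_gt0 Q_gt0' TE alE beE WE XE CiE DiE CjE DjE `|q|%N r%:~R (0 < X * E + r - W * E) ij.
  rewrite -PR -ZR -ER => /(_ P0R Z0R al0R rR r_in longE).
  rewrite -denR qR {longE}.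
  branch lg.
    move=> H.
    step e1 e1E; step e2 e2E; step e3 e3E; step p3 p3E; step num numE.
    have numR : num%:~R = Ci%:~R * P%:~R + Cj%:~R * Z%:~R
        + E%:~R * ((1 + q%:~R) * Di%:~R + (1 + 1 + q%:~R) * Dj%:~R) :> R.
      by rewrite numE e1E e2E e3E !(rmorphD, rmorphM).
    do 17 eexists; split; [reflexivity | split; last by rewrite V'E].
    move=> _; rewrite expand_rle p1E q1E p2E q2E p3E q3E e1E e2E e3E !rmorphM numR.
    by case: H.
  move=> H; rewrite /= in H.
  step e1 e1E; step p3 p3E.
  have p3R : X%:~R * E%:~R + r%:~R = p3%:~R :> R by rewrite p3E rmorphD rmorphM.
  (* With the candidate statement left in the goal, the case analysis on the two tests also fixes
     its flags. *)
  move: H; rewrite p3R !ltr0z.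
  have [] : 0 <= (0 < r)%R%:Z /\ 0 <= (0 < p3)%R%:Z by [].
  rewrite ?dn_seqA; branch r0; step e2 e2E; branch p30; step e3 e3E; step num numE; move=> _ _ H;
  (do 17 eexists; split; [reflexivity | split; last by rewrite V'E]);
  (have numR : num%:~R = Ci%:~R * P%:~R + Cj%:~R * Z%:~R
        + E%:~R * ((e2%:~R + q%:~R) * Di%:~R + (e1%:~R + e3%:~R + q%:~R) * Dj%:~R) :> R
      by rewrite numE !(rmorphD, rmorphM));
  move=> _; rewrite expand_rle p1E q1E p2E q2E q3E !rmorphM numR e1E e2E e3E;
  by case: H.
have ij : i = j.
  by apply: val_inj; move: ijE; rewrite /a /b /=; set u := nat_of_ord i; set v := nat_of_ord j; nia.
have [fitsE safe_c cost_c le_c] := single_candidate R A sg t i j _ _ _ _ _ _ _ t_gt0 Q_gt0' ij TE alE WE XE CiE DiE.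
rewrite /single_prog; run P PE.
have PR : P%:~R = X%:~R + al%:~R * T%:~R :> R by rewrite PE rmorphD rmorphM.
move: fitsE safe_c; rewrite -PR ler0z ler_int => fitsE safe_c.
branch P0; last first.
  do 17 eexists; split; [reflexivity | split; rewrite VE ?ltxx //].
  by rewrite fitsE; move: P0; lia.
branch PW; last first.
  do 17 eexists; split; [reflexivity | split; rewrite VE ?ltxx //].
  by rewrite fitsE; move: PW; lia.
step V' V'E; step e1 e1E; step p1 p1E; step q1 q1E; step e2 e2E; step p2 p2E; step q2 q2E.
step e3 e3E; step p3 p3E; step q3 q3E; step e4 e4E; step num numE; step den denE.
have numR : num%:~R = Ci%:~R * T%:~R + Di%:~R :> R by rewrite numE rmorphD rmorphM.
have denR : den%:~R = Q%:~R ^+ 2 :> R by rewrite denE rmorphM expr2.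
have P_in : 0 <= P <= W by move: P0 PW; lia.
do 17 eexists; split; [reflexivity | split; last by rewrite V'E].
move=> _; rewrite expand_rle e1E e2E e3E e4E p2E q2E numR denR; split=> //.
  by rewrite denE mulr_gt0.
exact: safe_c.
Qed.
End Semantics.

(** * Input layout and numbering of the candidates *)

Section Input.
Variables (A : mms) (tmax : rat).

Let inp := encode_input A tmax.

Lemma nth_encode_mode (m : mode A) r : (r < 6)%N ->
  inp`_(9 + 6 * m + r) = (encode_rat (rate m) ++ encode_rat (ccost m) ++ encode_rat (dcost m))`_r.
Proof.
move=> r6; pose f (m : mode A) := encode_rat (rate m) ++ encode_rat (ccost m) ++ encode_rat (dcost m).
have szf x : size (f x) = 6%N by [].
have flatE s k : (k < size s)%N -> (flatten [seq f x | x <- s])`_(6 * k + r) = (f (nth m s k))`_r.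
  elim: s k => [//|x s IH] [_|k k_lt].
    have catE : flatten [seq f y | y <- x :: s] = f x ++ flatten [seq f y | y <- s] by [].
    by rewrite catE nth_cat szf muln0 r6.
  have catE : flatten [seq f y | y <- x :: s] = f x ++ flatten [seq f y | y <- s] by [].
  rewrite catE nth_cat szf mulnS -addnA ltnNge leq_addr addKn; exact: IH.
have -> : inp = [:: numq tmax; denq tmax; (nmodes A)%:Z; numq (vmin A); denq (vmin A);
    numq (vmax A); denq (vmax A); numq (v0 A); denq (v0 A)] ++ flatten [seq f x | x <- enum (mode A)].
  by [].
rewrite nth_cat [size _]/= -addnA ltnNge leq_addr /= addKn flatE ?nth_ord_enum //.
by rewrite size_enum_ord.
Qed.

Lemma scale_rat (R : realType) (q : rat) (Q : int) : (denq q %| Q)%Z ->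
  (numq q * divz Q (denq q))%:~R = ratr q * Q%:~R :> R.
Proof.
move=> dvd; rewrite -[in RHS](divzK dvd) /ratr rmorphM [(divz _ _ * _)%:~R]rmorphM /=.
have : (denq q)%:~R != 0 :> R by rewrite intr_eq0 denq_neq0.
by move=> ?; field.
Qed.

Definition code (sg : bool) (i j : mode A) : nat := ((i * nmodes A + j).*2 + sg)%N.

Lemma code_inj sg i j sg' i' j' : code sg i j = code sg' i' j' -> [/\ sg = sg', i = i' & j = j'].
Proof.
rewrite /code => eq_code; have eq_sg : sg = sg'.
  by have := congr1 odd eq_code; rewrite !oddD !odd_double; case: (sg); case: (sg').
have k_gt0 : (0 < nmodes A)%N by case: (i) => m; lia.
have eq_ij : (i * nmodes A + j = i' * nmodes A + j')%N by move: eq_code; rewrite eq_sg; lia.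
split=> //; apply: val_inj => /=.
  by have := congr1 (divn^~ (nmodes A)) eq_ij; rewrite !divnMDl // !divn_small // !addn0.
by have := congr1 (modn^~ (nmodes A)) eq_ij; rewrite !modnMDl !modn_small.
Qed.

Lemma code_surj n : (n < 2 * nmodes A * nmodes A)%N -> exists sg i j, n = code sg i j.
Proof.
set k := nmodes A => n_lt; have k_gt0 : (0 < k)%N by case: (k) n_lt => //; rewrite muln0.
have i_lt : (n./2 %/ k < k)%N by rewrite ltn_divLR //; lia.
have j_lt : (n./2 %% k < k)%N by rewrite ltn_mod.
exists (odd n), (Ordinal i_lt), (Ordinal j_lt).
by rewrite /code /= -/k -divn_eq addnC odd_double_half.
Qed.

Lemma code_lt sg i j : (code sg i j < 2 * nmodes A * nmodes A)%N.
Proof.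
rewrite /code; have := ltn_ord i; have := ltn_ord j; set a := nat_of_ord i; set b := nat_of_ord j.
case: sg; nia.
Qed.

(** The counter is decremented before being decoded: the value n + 1 at the test leads to candidate
    n. *)
Lemma dn_decode sg i j x1 x2 x3 rest :
  dn decode_prog (inp, [:: Posz (code sg i j).+1, x1, x2, x3 & rest]) =
  (inp, [:: Posz (code sg i j), Posz (9 + 6 * i)%N, Posz (9 + 6 * j)%N, if sg then -1 else 1 & rest]).
Proof.
have k_gt0 : (0 < nmodes A)%N by case: (i) => m; lia.
rewrite /decode_prog; step c cE; have {}cE : c = Posz (code sg i j) by rewrite cE; lia.
step p pE; step q qE; step s sE.
have half : divz (Posz (code sg i j)) 2 = Posz (i * nmodes A + j)%N.
  by rewrite divz_nat divn2 /code halfD odd_double /= doubleK; case: (sg) => /=; rewrite ?addn0.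
have quot : divz (Posz (code sg i j)) (2 * Posz (nmodes A)) = Posz i.
  by rewrite divzMA_ge0 // half divz_nat divnMDl // divn_small // addn0.
congr (_, [:: _, _, _, _ & _]) => //.
- by rewrite pE cE quot.
- rewrite qE cE half quot; lia.
rewrite sE cE half /code; case: (sg); lia.
Qed.
End Input.

(** * Maintaining the best candidate *)

Section Search.
Variables (R : realType) (A : mms) (tmax : rat).
Hypothesis tmax_gt0 : 0 < tmax.
Implicit Types (sg : bool) (i j : mode A) (u : R) (regs : seq int).

Let inp := encode_input A tmax.
Let t : R := ratr tmax.

Definition best_rle regs i j : rle_schedule A :=
  rle A i j regs`_35 regs`_36 regs`_37 regs`_38 regs`_39 regs`_40 regs`_41 regs`_42 regs`_43
    regs`_44 regs`_45 regs`_46 regs`_47.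

(** The first alternative is the initial fraction 1 / 0, an infinite cost. *)
Definition best_ok regs : Prop :=
  regs`_31 = 1 /\ regs`_32 = 0 \/
  exists i j, [/\ regs`_33 = Posz i, regs`_34 = Posz j, 0 < regs`_32,
    [/\ 0 <= regs`_35, 0 <= regs`_38, 0 <= regs`_41 & 0 <= regs`_44]
    & safe_schedule t (expand R (best_rle regs i j)) /\
      total_cost (expand R (best_rle regs i j)) * (regs`_32)%:~R = (regs`_31)%:~R].

Definition best_le regs u : Prop := 0 < regs`_32 /\ (regs`_31)%:~R <= u * (regs`_32)%:~R.

Lemma load_values sg i j (Q T al be W X Ci Di Cj Dj : int) :
  let scaled n d := inp`_n * divz Q inp`_d in
  let a := (9 + 6 * i)%N in let b := (9 + 6 * j)%N in
  let s : int := if sg then -1 else 1 in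
  [/\ Q = inp`_1 * inp`_4 * inp`_6 * inp`_8 * inp`_(a + 1)%N * inp`_(a + 3)%N * inp`_(a + 5)%N
              * inp`_(b + 1)%N * inp`_(b + 3)%N * inp`_(b + 5)%N,
      T = scaled 0 1 /\ W = Q * (scaled 5 6 - scaled 3 4),
      al = s * scaled (a + 0)%N (a + 1)%N /\ be = - (s * scaled (b + 0)%N (b + 1)%N),
      X = Q * (if 0 < s then scaled 7 8 - scaled 3 4 else scaled 5 6 - scaled 7 8)
    & [/\ Ci = scaled (a + 2)%N (a + 3)%N, Di = Q * scaled (a + 4)%N (a + 5)%N,
          Cj = scaled (b + 2)%N (b + 3)%N & Dj = Q * scaled (b + 4)%N (b + 5)%N]] ->
  [/\ 0 < Q, T%:~R = t * Q%:~R /\ W%:~R = width R A * Q%:~R ^+ 2,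
      al%:~R = slope R A sg i * Q%:~R /\ be%:~R = - slope R A sg j * Q%:~R,
      X%:~R = start R A sg * Q%:~R ^+ 2
    & [/\ Ci%:~R = (ratr (ccost i) : R) * Q%:~R, Di%:~R = (ratr (dcost i) : R) * Q%:~R ^+ 2,
          Cj%:~R = (ratr (ccost j) : R) * Q%:~R & Dj%:~R = (ratr (dcost j) : R) * Q%:~R ^+ 2]].
Proof.
move=> scaled a b s [QE [TE WE] [alE beE] XE [CiE DiE CjE DjE]].
have fieldE m r := nth_encode_mode A tmax m r.
have Q_gt0 : 0 < Q.
  by rewrite QE /a /b !fieldE //= !mulr_gt0 ?denq_gt0.
have dvdQ d : d \in [:: inp`_1; inp`_4; inp`_6; inp`_8; inp`_(a + 1)%N; inp`_(a + 3)%N;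
    inp`_(a + 5)%N; inp`_(b + 1)%N; inp`_(b + 3)%N; inp`_(b + 5)%N] -> (d %| Q)%Z.
  rewrite QE !inE; do ?[case/orP]; move/eqP=> ->;
  by repeat first [exact: dvdzz | apply: dvdz_mull; exact: dvdzz | apply: dvdz_mulr].
have sc n d (q : rat) : inp`_n = numq q -> inp`_d = denq q -> (inp`_d %| Q)%Z ->
    (scaled n d)%:~R = ratr q * Q%:~R :> R.
  by move=> n_q d_q; rewrite /scaled n_q d_q; exact: scale_rat.
have sT : (scaled 0%N 1%N)%:~R = t * Q%:~R :> R by apply: sc => //; apply: dvdQ; rewrite !inE eqxx ?orbT.
have sMin : (scaled 3%N 4%N)%:~R = ratr (vmin A) * Q%:~R :> R.
  by apply: sc => //; apply: dvdQ; rewrite !inE eqxx ?orbT.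
have sMax : (scaled 5%N 6%N)%:~R = ratr (vmax A) * Q%:~R :> R.
  by apply: sc => //; apply: dvdQ; rewrite !inE eqxx ?orbT.
have s0 : (scaled 7%N 8%N)%:~R = ratr (v0 A) * Q%:~R :> R.
  by apply: sc => //; apply: dvdQ; rewrite !inE eqxx ?orbT.
have sm (m : mode A) : m = i \/ m = j -> let c := (9 + 6 * m)%N in
   [/\ (scaled (c + 0)%N (c + 1)%N)%:~R = ratr (rate m) * Q%:~R :> R,
       (scaled (c + 2)%N (c + 3)%N)%:~R = ratr (ccost m) * Q%:~R :> R
     & (scaled (c + 4)%N (c + 5)%N)%:~R = ratr (dcost m) * Q%:~R :> R].
  move=> mij c; split; apply: sc; rewrite ?fieldE //; rewrite -[X in (X %| _)%Z]fieldE //; apply: dvdQ;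
  by case: mij => ->; rewrite !inE eqxx ?orbT.
have [ri ci di] := sm i (or_introl erefl); have [rj cj dj] := sm j (or_intror erefl).
split=> //; [split | split | | split=> //].
- by rewrite TE.
- by rewrite WE rmorphM rmorphB /= sMin sMax /width; ring.
- by rewrite alE rmorphM /= ri /slope /s; case: (sg); rewrite ?expr1 ?expr0; ring.
- by rewrite beE rmorphN rmorphM /= rj /slope /s; case: (sg); rewrite ?expr1 ?expr0; ring.
- rewrite XE /start /width /elevation /s; case: (sg) => /=; rewrite rmorphM rmorphB /= ?s0 ?sMin ?sMax; ring.
- by rewrite CiE.
- by rewrite DiE rmorphM /= di; ring.
- by rewrite CjE.
- by rewrite DjE rmorphM /= dj; ring.
Qed.

(** The stored schedule is replaced only when the cost strictly drops, so earlier bounds persist,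
    and a fitting candidate is either stored or already matched. The registers are listed singly so
    that symbolic execution computes. *)
Lemma dn_main sg i j x0 x4 x5 x6 x7 x8 x9 x10 x11 x12 x13 x14 x15 x16 x17 x18 x19 x20 x21 x22 x23 x24 x25 x26 x27 x28 x29 x30 x31 x32 x33 x34 x35 x36 x37 x38 x39 x40 x41 x42 x43 x44 x45 x46 x47 :
  let s : int := if sg then -1 else 1 in
  let regs := [:: x0; Posz (9 + 6 * i)%N; Posz (9 + 6 * j)%N; s; x4; x5; x6; x7; x8; x9; x10; x11; x12; x13; x14; x15; x16; x17; x18; x19; x20; x21; x22; x23; x24; x25; x26; x27; x28; x29; x30; x31; x32; x33; x34; x35; x36; x37; x38; x39; x40; x41; x42; x43; x44; x45; x46; x47] in
  best_ok regs ->
  exists regs', [/\ dn main_prog (inp, regs) = (inp, regs'), size regs' = 48%N /\ regs'`_0 = x0,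
    best_ok regs', forall u, best_le regs u -> best_le regs' u
    & fits R A sg t i j -> best_le regs' (estimate R A sg t i j)].
Proof.
have t_gt0 : 0 < t by rewrite /t ltr0q.
move=> s regs ok.
have [Q [T [al [be [W [X [Ci [Di [Cj [Dj [dn_l values]]]]]]]]]]] :=
  dn_load inp x0 (9 + 6 * i) (9 + 6 * j) s x4 x5 x6 x7 x8 x9 x10 x11 x12 x13 [:: x14; x15; x16; x17; x18; x19; x20; x21; x22; x23; x24; x25; x26; x27; x28; x29; x30; x31; x32; x33; x34; x35; x36; x37; x38; x39; x40; x41; x42; x43; x44; x45; x46; x47].
have [Q_gt0 [TE WE] [alE beE] XE [CiE DiE CjE DjE]] := load_values sg i j _ _ _ _ _ _ _ _ _ _ values.
have [V [y15 [y16 [y17 [y18 [e1 [p1 [q1 [e2 [p2 [q2 [e3 [p3 [q3 [e4 [num [den [dn_p [good V_fits]]]]]]]]]]]]]]]]]]] :=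
  dn_plan R A inp sg t i j x0 s Q T al be W X Ci Di Cj Dj x14 x15 x16 x17 x18 x19 x20 x21 x22
    x23 x24 x25 x26 x27 x28 x29 x30 [:: x31; x32; x33; x34; x35; x36; x37; x38; x39; x40; x41; x42; x43; x44; x45; x46; x47]
    t_gt0 Q_gt0 TE alE beE WE XE CiE DiE CjE DjE.
rewrite /main_prog.
rewrite dn_seq {}dn_l dn_seq {}dn_p /update_prog {values}.
branch V0; last first.
  eexists; split; [reflexivity | by [] | exact: ok | by [] | by move=> /V_fits; rewrite V0].
have [den_gt0 [e1_ge0 e2_ge0 e3_ge0 e4_ge0] safe_c cost_c le_c] := good V0.
have denR : 0 < den%:~R :> R by rewrite ltr0z.
branch better; last first.
  eexists; split; [reflexivity | by [] | exact: ok | by [] |] => _.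
  have {}better : x31 * den <= num * x32 by rewrite -subr_le0 leNgt better.
  (* Against the initial 1 / 0 the comparison reads [0 < den] and succeeds, so a rejection means
     that a schedule is stored. *)
  case: ok better => [[/= -> ->]|[i' [j' [_ _ /= x32_gt0 _ _]]]]; first by rewrite mul1r mulr0 leNgt den_gt0.
  rewrite -(ler_int R) !rmorphM /= => better; split=> //=.
  have x32R : 0 < x32%:~R :> R by rewrite ltr0z.
  by rewrite -(ler_pM2r denR) (le_trans better) // mulrAC ler_pM2r.
step bn bnE; step bd bdE; step mi miE; step mj mjE.
step f1 f1E; step g1 g1E; step h1 h1E; step f2 f2E; step g2 g2E; step h2 h2E.
step f3 f3E; step g3 g3E; step h3 h3E; step f4 f4E; step w wE; step h4 h4E; step h5 h5E.
have bdR : 0 < bd%:~R :> R by rewrite ltr0z bdE.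
eexists; split; [reflexivity | by [] | right; exists i, j | |].
- split=> /=; rewrite ?miE ?mjE ?bdE ?f1E ?f2E ?f3E ?f4E //.
  + by rewrite [Posz (9 + _)]PoszD addrC addKr PoszM mulrC mulzK.
  + by rewrite [Posz (9 + _)]PoszD addrC addKr PoszM mulrC mulzK.
  by rewrite /best_rle /= ?f1E ?g1E ?h1E ?f2E ?g2E ?h2E ?f3E ?g3E ?h3E ?f4E wE h4E h5E bnE.
- move=> u [/= x32_gt0 le_u]; split; first by rewrite /= bdE.
  have x32R : 0 < x32%:~R :> R by rewrite ltr0z.
  move: better; rewrite subr_gt0 -(ltr_int R) !rmorphM /= => better.
  rewrite /= bnE bdE -(ler_pM2r x32R) (le_trans (ltW better)) //.
  by rewrite mulrAC ler_pM2r.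
by move=> _; split; rewrite /= ?bnE bdE.
Qed.

Lemma dn_main_seq sg i j x0 x : size x = 44%N ->
  let s : int := if sg then -1 else 1 in
  let regs := [:: x0, Posz (9 + 6 * i)%N, Posz (9 + 6 * j)%N, s & x] in
  best_ok regs ->
  exists regs', [/\ dn main_prog (inp, regs) = (inp, regs'), size regs' = 48%N /\ regs'`_0 = x0,
    best_ok regs', forall u, best_le regs u -> best_le regs' u
    & fits R A sg t i j -> best_le regs' (estimate R A sg t i j)].
Proof.
do 44! [case: x => // ? x]; case: x => // _; move=> s regs; exact: dn_main.
Qed.
End Search.

(** * The search loop *)

Lemma leq_description s z : z \in s -> (bits z <= description_size s)%N.
Proof. by move=> zs; rewrite /description_size (big_rem z) //= leq_addr. Qed.

Lemma size_description s : (size s <= description_size s)%N.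
Proof.
by rewrite -sum1_size /description_size; apply: leq_sum => z _.
Qed.

Lemma input_size_ge A tmax :
  [/\ (0 < input_size A tmax)%N, (nmodes A <= input_size A tmax)%N
    & forall k, (bits (encode_input A tmax)`_k <= input_size A tmax)%N].
Proof.
have pos : (0 < input_size A tmax)%N.
  by rewrite /input_size addn_gt0 (leq_trans _ (size_description _)).
split=> //.
- rewrite /input_size (leq_trans _ (leq_addr _ _)) // (leq_trans _ (size_description _)) //.
  have gen (f : mode A -> seq int) ms : (forall m, (0 < size (f m))%N) ->
      (size ms <= size (flatten [seq f m | m <- ms]))%N.
    by move=> f_gt0; elim: ms => //= m ms IH; rewrite size_cat -addn1 addnC leq_add.
  rewrite /encode_system -[X in (X <= _)%N](size_enum_ord (nmodes A)) -cat1s !size_cat.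
  do 4! apply: leq_trans (leq_addl _ _); exact: gen.
move=> k; have [k_lt|k_ge] := ltnP k (size (encode_input A tmax)); last by rewrite nth_default.
have := mem_nth 0 k_lt; rewrite mem_cat => /orP[] /leq_description h; apply: leq_trans h _.
  exact: leq_addl.
exact: leq_addr.
Qed.

Lemma sim_init inp n : sim (init_memory inp) (inp, nseq n 0).
Proof. by case=> k //=; rewrite nth_nseq if_same. Qed.

Definition start_env : env := (1%N, [::]).

Lemma bounded_start B st : bounded B (an init_prog start_env) st -> bounded B loop_env st.
Proof.
have check w v : [&& (w.1 <= v.1)%N, (size w.2 <= 48)%N &
    all (fun r => nth 1 w.2 r <= nth 1 v.2 r)%N (iota 0 48)] && (size v.2 == 48%N) ->
    bounded B w st -> bounded B v st.
  move=> /andP[/and3P[le1 sz_w /allP le2] /eqP sz_v]; apply: bounded_leq => // r.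
  have [r_lt|r_ge] := ltnP r 48; first by apply: le2; rewrite mem_iota.
  by rewrite !nth_default ?sz_v // (leq_trans sz_w).
by apply: check; vm_compute.
Qed.

Definition iteration_time : nat :=
  (wt_time loop_env (Read (Const (Negz 0))) + wt loop_env (Read (Const (Negz 0)))
   + (an_time decode_prog loop_env + an_time main_prog (an decode_prog loop_env)))%N.

Section Loop.
Variables (R : realType) (A : mms) (tmax : rat).
Hypothesis tmax_gt0 : 0 < tmax.

Let inp := encode_input A tmax.
Let N := input_size A tmax.
Let t : R := ratr tmax.
Let total := (2 * nmodes A * nmodes A)%N.

(** The counter runs downwards, and the candidates with code at least [n] have been tried: none when
    [n] is [total], all when it is 0. *)
Definition searched (n : nat) (mem : memory) : Prop :=
  exists regs, [/\ sim mem (inp, regs), size regs = 48%N, regs`_0 = Posz n /\ (n <= total)%N,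
    bounded N loop_env (inp, regs) &
    best_ok R A tmax regs /\
    forall sg i j, (n <= code A sg i j)%N -> fits R A sg t i j ->
      best_le R regs (estimate R A sg t i j)].

Let N_gt0 : (0 < N)%N. Proof. by have [] := input_size_ge A tmax. Qed.

(** Two bits for the factor 2 and [N] for each factor [nmodes A] make [2 + 2 * N], at most
    [4 * N]. *)
Lemma bits_counter n : (n <= total)%N -> (bits (Posz n) <= 4 * N)%N.
Proof.
move=> n_le; have [_ _ bd] := input_size_ge A tmax.
have k_le : (bits (Posz (nmodes A)) <= N)%N by exact: (bd 2%N).
have : (bits (Posz n) <= bits (2%:Z * (nmodes A)%:Z * (nmodes A)%:Z))%N by apply: leq_bits; lia.
move=> /leq_trans; apply; apply: leq_trans (bitsM _ _) _.
apply: leq_trans (leq_add (bitsM _ _) (leqnn _)) _; have -> : bits 2%:Z = 2%N by [].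
by move: N_gt0 k_le; move: (bits _) => b; lia.
Qed.

Lemma search_step n mem : searched n.+1 mem ->
  exists mem' time, [/\ exec loop_body mem mem' time, (time <= iteration_time * N ^ 2)%N
    & searched n mem'].
Proof.
move=> [regs [sm sz [r0 n_le] bd [ok le_u]]].
have [sg [i [j nE]]] := code_surj A n n_le.
move: regs sz sm r0 bd ok le_u => [//|c0 [//|c1 [//|c2 [//|c3 rest]]]] sz sm /= r0 bd ok le_u.
have {sz}sz : size rest = 44%N by case: sz.
rewrite nE in r0; rewrite {}r0 in sm bd ok le_u.
have [mem1 [t1 [ex1 sm1 bd1 le1]]] :=
  exec_dn [::] N N_gt0 decode_prog loop_env mem _ okc_decode sm bd (fun r rin => match notF rin with end).
rewrite dn_decode in sm1 bd1.
have ptr : pointers [:: 1%N; 2%N]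
    (inp, [:: Posz (code A sg i j), Posz (9 + 6 * i)%N, Posz (9 + 6 * j)%N, if sg then -1 else 1 & rest]).
  by move=> r; rewrite !inE => /orP[] /eqP ->.
have [mem2 [t2 [ex2 sm2 bd2 le2]]] := exec_dn _ N N_gt0 main_prog _ mem1 _ okc_main sm1 bd1 ptr.
have ok1 : best_ok R A tmax
    [:: Posz (code A sg i j), Posz (9 + 6 * i)%N, Posz (9 + 6 * j)%N, if sg then -1 else 1 & rest].
  exact: ok.
have [regs' [dnE [sz' r0'] ok' mono fits_le]] := dn_main_seq R A tmax tmax_gt0 sg i j _ _ sz ok1.
rewrite dnE -an_seq -/loop_body in sm2 bd2.
exists mem2, (t1 + t2)%N; split; first exact: ExecSeq ex1 ex2.
  apply: leq_trans (leq_add le1 le2) _; rewrite -mulnDl leq_mul2r; apply/orP; right.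
  by rewrite /iteration_time leq_addl.
exists regs'; split; [exact: sm2 | exact: sz' | | |].
- by rewrite r0' -nE; split; [by [] | exact: ltnW].
- by apply: (bounded_renews _ _ _ _ loop_env_renews bd2); rewrite [_`_0]r0' -nE; apply: bits_counter; exact: ltnW.
split; first exact: ok'.
move=> sg' i' j'; rewrite leq_eqVlt => /orP[/eqP codeE|code_gt].
  rewrite nE in codeE; have [<- <- <-] := code_inj _ _ _ _ _ _ _ codeE.
  exact: fits_le.
by move=> fit; apply: mono; apply: le_u.
Qed.

Lemma search_loop n mem : searched n mem ->
  exists mem' time, [/\ exec (While (Read (Const (Negz 0))) loop_body) mem mem' time,
    (time <= iteration_time * N ^ 2 * n.*2.+1)%N & searched 0 mem'].
Proof.
apply: exec_while => [m mem1 [regs [sm _ [r0 _] bd _]]|m mem1]; last exact: search_step.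
have oke0 : oke [::] (Read (Const (Negz 0))) by [].
have ptr : pointers [::] (inp, regs) by [].
split; first by rewrite (sim_eval mem1 _ _ sm) /= r0.
have := wt_timeP [::] N N_gt0 loop_env _ mem1 _ oke0 sm bd ptr.
have := wtP [::] N N_gt0 loop_env _ _ oke0 bd ptr; rewrite (sim_eval mem1 _ _ sm) => le1 le2.
apply: leq_trans (leq_add le2 le1) _; rewrite /iteration_time mulnDl.
apply: leq_trans (leq_addr _ _); rewrite mulnDl leq_add2l leq_mul2l.
by rewrite -[X in (X <= _)%N]expn1 leq_pexp2l // orbT.
Qed.

Lemma searched_init : exists mem time,
  [/\ exec init_prog (init_memory inp) mem time,
      (time <= an_time init_prog start_env * N ^ 2)%N & searched total mem].
Proof.
have [_ _ inp_le] := input_size_ge A tmax.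
have bd0 : bounded N start_env (inp, nseq 48 0).
  split=> [k|r]; first by rewrite mul1n.
  by rewrite nth_nseq if_same nth_nil mul1n.
have ptr : pointers [::] (inp, nseq 48 0) by [].
have [mem [time [ex sm bd le]]] := exec_dn [::] N N_gt0 init_prog start_env _ _ okc_init
  (sim_init inp 48) bd0 ptr.
have [regs [dnE sz r0 r31 r32]] : exists regs, [/\ dn init_prog (inp, nseq 48 0) = (inp, regs),
    size regs = 48%N, regs`_0 = Posz total, regs`_31 = 1 & regs`_32 = 0].
  rewrite [nseq 48 0]/= /init_prog; step c cE; step n nE; step d dE.
  eexists; split; [reflexivity | by [] | | by rewrite /= nE | by rewrite /= dE].
  by rewrite /= cE /total !PoszM.
rewrite dnE in sm bd.
exists mem, time; split; [exact: ex | exact: le | exists regs; split; [exact: sm | exact: sz | by [] | |]].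
  exact: bounded_start bd.
split; first by left.
by move=> sg i j; rewrite leqNgt code_lt.
Qed.

(** A safe schedule yields a fitting candidate by [estimate_le]; a search that stored nothing thus
    proves that there is none. *)
Lemma output_searched mem : searched 0 mem ->
  exists (out : option (rle_schedule A)) mem' time,
  [/\ exec output_prog mem mem' time, (time <= an_time output_prog loop_env * N ^ 2)%N,
    holds_output mem' (encode_output out)
    & match out with
      | Some c => safe_schedule t (expand R c) /\
          forall s : schedule R A, safe_schedule t s -> total_cost (expand R c) <= 3 * total_cost s
      | None => forall s : schedule R A, ~ safe_schedule t s
      end].
Proof.
move=> [regs [sm sz _ bd [ok le_u]]].
have ptr : pointers [::] (inp, regs) by [].
have [mem' [time [ex sm' _ le]]] := exec_dn [::] N N_gt0 output_prog loop_env _ _ okc_output sm bd ptr.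
have fits_le (s : schedule R A) : safe_schedule t s -> exists2 u, best_le R regs u & u <= 3 * total_cost s.
  move=> safe_s; have s_neq0 : s != [::].
    apply: contraTneq safe_s => ->; rewrite /safe_schedule /has_horizon big_nil /=.
    by rewrite eq_sym /t gt_eqF // ltr0q.
  have [sg [i [j /andP[fit le_s]]]] := estimate_le R A s t s_neq0 safe_s.
  by exists (estimate R A sg t i j) => //; apply: le_u.
case: ok => [[r31 r32]|[i [j [r33 r34 r32 [e1 e2 e3 e4] [safe_c cost_c]]]]].
  exists None, mem', time; split=> //.
    by case=> // _; rewrite sm' /output_prog dn_if1 /= r32.
  by move=> s /fits_le[u [r32_gt0]]; rewrite r32 in r32_gt0.
exists (Some (best_rle A regs i j)), mem', time; split=> //; last first.
  split=> // s /fits_le[u [_ le_31] le_s]; apply: le_trans le_s.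
  have r32R : 0 < (regs`_32)%:~R :> R by rewrite ltr0z.
  by rewrite -(ler_pM2r r32R) cost_c.
move: sm'; rewrite /output_prog dn_if1 [ev _ _]/= r32 => sm'.
have outE : encode_output (Some (best_rle A regs i j)) =
  [:: 1; 4; regs`_35; 1; regs`_34; regs`_36; regs`_37; regs`_38; 1; regs`_33; regs`_39; regs`_40;
      regs`_41; 1; regs`_34; regs`_42; regs`_43; regs`_44; 2; regs`_33; regs`_45; regs`_46;
      regs`_34; regs`_45; regs`_47].
  by rewrite /encode_output /best_rle /rle /= !gez0_abs // r33 r34.
rewrite outE => k k_lt; rewrite sm' -/inp; move: (inp) => cells; rewrite /=.
by do 25! [case: k k_lt => [_|k k_lt]; first by do ?rewrite nth_set_nth /=].
Qed.
End Loop.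

(** * The complete program *)

Definition time_bound : nat :=
  (wt_time start_env (Read (Const 0%:Z)) + wt start_env (Read (Const 0%:Z))
   + an_time init_prog start_env + iteration_time * 5 + an_time output_prog loop_env
   + an_time empty_prog start_env)%N.

Theorem theorem8 (R : realType) :
  exists (p : cmd) (C : nat), forall (A : mms) (tmax : rat), 0 <= tmax ->
  exists (out : option (rle_schedule A)) (mem : memory) (t : nat),
    [/\ exec p (init_memory (encode_input A tmax)) mem t,
        (t <= C * input_size A tmax ^ 7)%N,
        holds_output mem (encode_output out)
      & match out with
        | Some c =>
            safe_schedule (ratr tmax) (expand R c) /\
            forall s : schedule R A, safe_schedule (ratr tmax) s ->
              total_cost (expand R c) <= 3 * total_cost s
        | None => forall s : schedule R A, ~ safe_schedule (ratr tmax) s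
        end].
Proof.
exists solver, time_bound => A tmax tmax_ge0.
have [N_gt0 k_le inp_le] := input_size_ge A tmax; set N := input_size A tmax in N_gt0 k_le inp_le *.
set mem0 := init_memory _.
have sm0 := sim_init (encode_input A tmax) 48; rewrite -/mem0 in sm0.
have bd0 : bounded N start_env (encode_input A tmax, nseq 48 0).
  split=> [k|r]; first by rewrite mul1n.
  by rewrite nth_nseq if_same nth_nil mul1n.
have ptr : pointers [::] (encode_input A tmax, nseq 48 0) by [].
have ok0 : oke [::] (Read (Const 0%:Z)) by [].
have N2_7 : (N ^ 2 <= N ^ 7)%N by rewrite leq_pexp2l.
have N1_7 : (N <= N ^ 7)%N by rewrite -[X in (X <= _)%N]expn1 leq_pexp2l.
have test_le := wt_timeP [::] N N_gt0 start_env _ mem0 _ ok0 sm0 bd0 ptr.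
have value_le := wtP [::] N N_gt0 start_env _ _ ok0 bd0 ptr.
rewrite -(sim_eval mem0 _ _ sm0) in value_le.
(* The sign of the numerator detects horizon 0, where the empty schedule has cost 0. *)
have [tmax_pos|tmax_neg] := boolP (0 < eval mem0 (Read (Const 0%:Z))); last first.
  have tmax0 : tmax = 0.
    by apply/eqP; rewrite -numq_eq0 eq_le numq_le0 leNgt -numq_gt0 tmax_neg numq_ge0.
  have [mem [time [ex sm _ le]]] := exec_dn [::] N N_gt0 empty_prog start_env _ _ okc_empty sm0 bd0 ptr.
  exists (Some [::]), mem; eexists; split.
  - by apply: ExecIfFalse ex; rewrite leNgt.
  - rewrite /time_bound; move: test_le value_le le N2_7 N1_7.
    move: (cost_expr _ _) (bits _) (wt_time _ _) (wt _ _) (an_time _ _) => a b c d e.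
    move: (an_time _ _) iteration_time (an_time _ _) (N ^ 2)%N (N ^ 7)%N => f g h n2 n7; nia.
  - by case=> [|[|//]] _; rewrite sm.
  rewrite tmax0 rmorph0; split.
    rewrite /safe_schedule /has_horizon /= big_nil eqxx /safe /= !ler_rat v0_range.
    by [].
  move=> s /andP[/andP[pos _] _]; rewrite /total_cost big_nil.
  by rewrite mulr_ge0 // total_cost_ge0.
have tmax_gt0 : 0 < tmax by rewrite -numq_gt0.
have [mem1 [t1 [ex1 le1 se1]]] := searched_init R A tmax.
have [mem2 [t2 [ex2 le2 se2]]] := search_loop R A tmax tmax_gt0 _ _ se1.
have [out [mem3 [t3 [ex3 le3 holds spec]]]] := output_searched R A tmax tmax_gt0 _ se2.
exists out, mem3; eexists; split; [|  | exact: holds | exact: spec].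
  by apply: ExecIfTrue tmax_pos _; apply: ExecSeq ex1 _; apply: ExecSeq ex2 ex3.
have iterations : ((2 * nmodes A * nmodes A).*2.+1 <= 5 * N ^ 2)%N.
  by rewrite expnS expn1; move: k_le N_gt0; nia.
(* The loop takes O(N^2) passes of O(N^2) each; the resulting fourth power is relaxed to the
   seventh. *)
have {}le2 : (t2 <= iteration_time * 5 * N ^ 7)%N.
  move: le2; move: iteration_time => K le2.
  apply: leq_trans le2 _; rewrite -(mulnA K) -(mulnA K 5) leq_mul2l; apply/orP; right.
  apply: leq_trans (leq_mul (leqnn _) iterations) _.
  by rewrite mulnCA -expnD leq_mul2l leq_pexp2l.
rewrite /time_bound; move: test_le value_le le1 le2 le3 N2_7 N1_7.
move: (cost_expr _ _) (bits _) (wt_time _ _) (wt _ _) (an_time _ _) => a b c d e.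
move: (an_time _ _) iteration_time (an_time _ _) (N ^ 2)%N (N ^ 7)%N => f g h n2 n7; nia.
Qed.
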